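(* Let $R$ be a commutative noetherian ring and let $M$ be a finitely generated $R$-module which has reducible complexity. Then $M$ satisfies the Auslander condition, the uniform Auslander condition, the Auslander--Reiten conjecture, the generalized Auslander--Reiten conjecture, and dependence of the total reflexivity conditions.
   Context: All modules are finitely generated. Reducible complexity is Bergh's notion, defined for modules over a (commutative noetherian) local ring as follows. The complexity $\operatorname{cx}X$ of a module $X$ is the least integer $c\ge 0$ such that the Betti numbers $\beta_n(X)$ are bounded by $\alpha n^{c-1}$ for some real number $\alpha$ and all $n\gg0$ ($\infty$ if no such $c$ exists). Given a homogeneous element $\eta\in\operatorname{Ext}^t_R(X,X)$ of degree $t\ge1$, represent it by a homomorphism $f:\Omega^tX\to X$, where $\Omega^jX$ is the $j$-th syzygy in the minimal free resolution $(P_j)$ of $X$. The pushout of $0\to\Omega^tX\to P_{t-1}\to\Omega^{t-1}X\to0$ along $f$ gives an exact sequence $0\to X\to K_\eta\to\Omega^{t-1}X\to0$, which defines $K_\eta$. Modules of reducible complexity form the class, inside the modules of finite complexity, defined inductively by: (i) every module of finite projective dimension has reducible complexity; (ii) a module $X$ of finite positive complexity has reducible complexity if there is a homogeneous element $\eta\in\operatorname{Ext}^*_R(X,X)$ of positive degree such that $\operatorname{cx}K_\eta<\operatorname{cx}X$, $\operatorname{depth}K_\eta=\operatorname{depth}X$, and $K_\eta$ has reducible complexity. Let $M$ be a module; $\operatorname{Ext}^{\gg0}_R(M,N)=0$ means $\operatorname{Ext}^i_R(M,N)=0$ for all sufficiently large $i$. - Auslander condition: there is an integer $b_M\ge0$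 such that for every $N$ with $\operatorname{Ext}_R^{\gg0}(M,N)=0$ one has $\operatorname{Ext}_R^{i}(M,N)=0$ for all $i>b_M$. - Uniform Auslander condition: there is an integer $b_M\ge0$ such that for every $N\ne 0$ with $\operatorname{Ext}_R^{\gg0}(M,N)=0$ one has $\operatorname{Ext}_R^{i}(M,N)=0$ for all $i>b_M$ and $\operatorname{Ext}_R^{b_M}(M,N)\neq0$. - Auslander--Reiten conjecture (for $M$): if $\operatorname{Ext}_R^{i}(M,M\oplus R)=0$ for all $i>0$, then $M$ is projective. - Generalized Auslander--Reiten conjecture (for $M$): whenever $n\ge 0$ is an integer with $\operatorname{Ext}_R^{i}(M,M\oplus R)=0$ for all $i>n$, one has $\operatorname{pd}_RM\le n$. - Dependence of the total reflexivity conditions: if $\operatorname{Ext}_R^{i}(M,R)=0$ for all $i>0$, then $M$ is totally reflexive.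
   Formalization: The uniform Auslander condition is asserted only for nonzero M: for M = 0, which has reducible complexity, it fails, since all Ext(0,N) vanish while N ≠ 0 qualifies; the other four conclusions are for every M. *)

(* Defs.v *)
From HB Require Import structures.
From Stdlib Require Rdefinitions.
From mathcomp Require Import all_boot all_order all_algebra.
From mathcomp Require Import boolp classical_sets Rstruct.

Set Implicit Arguments.
Unset Strict Implicit.
Unset Printing Implicit Defensive.

Import Order.TTheory GRing.Theory Num.Theory.
Local Open Scope classical_set_scope.
Local Open Scope ring_scope.

(** * Commutative algebra *)

Section Modules.
Variable R : comNzRingType.
Implicit Types U V W M N : lmodType R.

Definition span M (s : seq M) : set M :=
  [set x | exists c : 'I_(size s) -> R, x = \sum_(i < size s) c i *: s`_i].

Definition finitely_generated M : Prop := exists s : seq M, span s = setT.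

Definition nonzero M : Prop := exists x : M, x != 0.

Definition ideal (I : set R) : Prop :=
  I 0 /\ forall a x y, I x -> I y -> I (a * x + y).

Definition ideal_span (s : seq R) : set R := @span R^o s.

Definition noetherian : Prop :=
  forall I : set R, ideal I -> exists s : seq R, I = ideal_span s.

Definition maximal_ideal (m : set R) : Prop :=
  [/\ ideal m, m <> setT &
      forall I : set R, ideal I -> m `<=` I -> I <> setT -> I = m].

(** [local_ring m]: R is a local ring and m is its maximal ideal. *)
Definition local_ring (m : set R) : Prop :=
  maximal_ideal m /\ forall n : set R, maximal_ideal n -> n = m.

(** The submodule I M of M. *)
Definition ideal_mul (I : set R) M : set M :=
  [set x | exists n (a : 'I_n -> R) (y : 'I_n -> M),
     (forall i, I (a i)) /\ x = \sum_(i < n) a i *: y i].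

Definition surjective_map (U V : Type) (f : U -> V) : Prop :=
  forall y, exists x, f x = y.

Definition exact U V W (f : {linear U -> V}) (g : {linear V -> W}) : Prop :=
  forall y, g y = 0 <-> exists x, f x = y.

Definition projective M : Prop :=
  forall U V (g : {linear U -> V}) (f : {linear M -> V}),
    surjective_map g -> exists h : {linear M -> U}, forall x, g (h x) = f x.

Definition free_of_rank M (n : nat) : Prop :=
  exists f : {linear 'rV[R]_n -> M}, bijective f.

End Modules.

Arguments ideal_mul {R} I M.

(** The kernel of a linear map, as a module. *)
Section Kernel.
Variables (R : comNzRingType) (U V : lmodType R) (f : {linear U -> V}).

Definition kernel_pred : {pred U} := fun x => f x == 0.

Lemma kernel_submod_closed : submod_closed kernel_pred.
Proof.
split=> [|a u v]; rewrite /in_mem /= /kernel_pred /= ?linear0 //.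
by move=> /eqP fu /eqP fv; rewrite linearP fu fv scaler0 addr0.
Qed.

HB.instance Definition _ :=
  GRing.isSubmodClosed.Build R U kernel_pred kernel_submod_closed.

Record kernel : Type :=
  Kernel { kernel_val :> U; kernel_valP : kernel_val \in kernel_pred }.

HB.instance Definition _ := [isSub for kernel_val].
HB.instance Definition _ := [Choice of kernel by <:].
HB.instance Definition _ := [SubChoice_isSubLmodule of kernel by <:].

Definition kernel_incl : {linear kernel -> U} := \val.

End Kernel.

(** The module Hom(U, V), carried by the type [{linear U -> V}]. *)
Section Hom.
Variables (R : comNzRingType) (U V : lmodType R).
Implicit Types f g h : {linear U -> V}.

HB.instance Definition _ := gen_eqMixin {linear U -> V}.
HB.instance Definition _ := gen_choiceMixin {linear U -> V}.

Definition hom_zero : {linear U -> V} := \0.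
Definition hom_opp f : {linear U -> V} := \- f.
Definition hom_add f g : {linear U -> V} := f \+ g.
Definition hom_scale (a : R) f : {linear U -> V} := a \*: f.

Lemma homP f g : f =1 g -> f = g.
Proof.
case: f g => f [[fa] [fl]] [g [[ga] [gl]]] /= fg.
have {}fg : f = g by apply: funext.
by subst g; rewrite (Prop_irrelevance fa ga) (Prop_irrelevance fl gl).
Qed.

Lemma hom_addA : associative hom_add.
Proof. by move=> f g h; apply: homP => x /=; rewrite addrA. Qed.
Lemma hom_addC : commutative hom_add.
Proof. by move=> f g; apply: homP => x /=; rewrite addrC. Qed.
Lemma hom_add0 : left_id hom_zero hom_add.
Proof. by move=> f; apply: homP => x /=; rewrite add0r. Qed.
Lemma hom_addN : left_inverse hom_zero hom_opp hom_add.
Proof. by move=> f; apply: homP => x /=; rewrite addNr. Qed.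

HB.instance Definition _ := GRing.isZmodule.Build {linear U -> V}
  hom_addA hom_addC hom_add0 hom_addN.

Lemma hom_scaleA a b f : hom_scale a (hom_scale b f) = hom_scale (a * b) f.
Proof. by apply: homP => x /=; rewrite scalerA. Qed.
Lemma hom_scale1 : left_id 1 hom_scale.
Proof. by move=> f; apply: homP => x /=; rewrite scale1r. Qed.
Lemma hom_scaleDr : right_distributive hom_scale +%R.
Proof. by move=> a f g; apply: homP => x /=; rewrite scalerDr. Qed.
Lemma hom_scaleDl f : {morph hom_scale^~ f : a b / a + b}.
Proof. by move=> a b; apply: homP => x /=; rewrite scalerDl. Qed.

HB.instance Definition _ := GRing.Zmodule_isLmodule.Build R {linear U -> V}
  hom_scaleA hom_scale1 hom_scaleDr hom_scaleDl.

End Hom.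

Definition dual (R : comNzRingType) (M : lmodType R) : lmodType R :=
  {linear M -> R^o}.

(** The evaluation map from M to its bidual. *)
Section Biduality.
Variables (R : comNzRingType) (M : lmodType R).

Definition eval_at (x : M) (f : dual M) : R^o := (f : {linear M -> R^o}) x.

Lemma eval_at_linear x : linear (eval_at x).
Proof. by []. Qed.
HB.instance Definition _ x :=
  GRing.isLinear.Build R (dual M) R^o *:%R (eval_at x) (eval_at_linear x).

Definition biduality (x : M) : dual (dual M) := (eval_at x : {linear dual M -> R^o}).

Definition reflexive_module : Prop := bijective biduality.

End Biduality.

(** * Resolutions, syzygies and Ext *)

Section Resolutions.
Variable R : comNzRingType.
Implicit Types M N W X Y K : lmodType R.

Record projective_resolution M := ProjectiveResolution {
  res_obj :> nat -> lmodType R;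
  res_diff : forall n, {linear res_obj n.+1 -> res_obj n};
  res_aug : {linear res_obj 0 -> M};
  res_projective : forall n, projective (res_obj n);
  res_aug_surj : surjective_map res_aug;
  res_exact0 : exact (res_diff 0) res_aug;
  res_exactS : forall n, exact (res_diff n.+1) (res_diff n)
}.

(** [Ext_zero M N i] is Ext^i(M, N) = 0: in the complex Hom(P, N), every
    i-cocycle is an i-coboundary.  The choice of P does not matter. *)
Definition cocycle M N (P : projective_resolution M) i (phi : {linear P i -> N}) :
  Prop := forall x, phi (res_diff P i x) = 0.

Definition coboundary M N (P : projective_resolution M) i :
    {linear P i -> N} -> Prop :=
  if i is j.+1 then
    fun phi => exists psi : {linear P j -> N}, forall x, phi x = psi (res_diff P j x)
  else fun phi => forall x, phi x = 0.

Definition Ext_zero M N (i : nat) : Prop :=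
  exists P : projective_resolution M,
    forall phi : {linear P i -> N}, cocycle phi -> coboundary phi.

Definition Ext_eventually_zero M N : Prop :=
  exists n, forall i, (n <= i)%N -> Ext_zero M N i.

Definition pd_le M (n : nat) : Prop :=
  exists P : projective_resolution M, forall i, (n < i)%N -> forall x : P i, x = 0.

Definition totally_reflexive M : Prop :=
  [/\ reflexive_module M,
      forall i, (0 < i)%N -> Ext_zero M R^o i &
      forall i, (0 < i)%N -> Ext_zero (dual M) R^o i].

(** The augmented complex, with M in position 0 and P_n in position n + 1. *)
Definition aug_obj M (P : projective_resolution M) (n : nat) : lmodType R :=
  if n is k.+1 then P k else M.

Definition aug_diff M (P : projective_resolution M) (n : nat) :
    {linear P n -> aug_obj P n} :=
  match n with 0 => res_aug P | k.+1 => res_diff P k end.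

(** The j-th syzygy: M itself for j = 0, and the kernel of P_{j-1} -> P_{j-2}
    (of P_0 -> M when j = 1) for j > 0. *)
Definition syzygy M (P : projective_resolution M) (j : nat) : lmodType R :=
  if j is k.+1 then kernel (aug_diff P k) else M.

Definition syzygy_incl M (P : projective_resolution M) (k : nat) :
  {linear syzygy P k.+1 -> P k} := kernel_incl (aug_diff P k).

(** [pushout f g j k]: the square j f = k g is cocartesian. *)
Definition pushout W X Y K (f : {linear W -> X}) (g : {linear W -> Y})
    (j : {linear X -> K}) (k : {linear Y -> K}) : Prop :=
  (forall w, j (f w) = k (g w)) /\
  forall (L : lmodType R) (j' : {linear X -> L}) (k' : {linear Y -> L}),
    (forall w, j' (f w) = k' (g w)) ->
    exists! h : {linear K -> L},
      (forall x, h (j x) = j' x) /\ (forall y, h (k y) = k' y).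

End Resolutions.

(** * Depth, complexity and reducible complexity over a local ring (R, m) *)

Section Local.
Variables (R : comNzRingType) (m : set R).
Implicit Types M N X K : lmodType R.

Definition regular_sequence X (s : seq R) : Prop :=
  [/\ forall i, (i < size s)%N -> m s`_i,
      forall i, (i < size s)%N -> forall y : X,
        ideal_mul (ideal_span (take i s)) X (s`_i *: y) ->
        ideal_mul (ideal_span (take i s)) X y &
      ideal_mul (ideal_span s) X <> setT].

Definition is_depth X (d : nat) : Prop :=
  (exists2 s, regular_sequence X s & size s = d) /\
  forall s, regular_sequence X s -> (size s <= d)%N.

(** P is a minimal free resolution, and b is the sequence of its ranks. *)
Definition minimal_free X (P : projective_resolution X) (b : nat -> nat) : Prop :=
  (forall n, free_of_rank (P n) (b n)) /\
  (forall n x, ideal_mul m (P n) (res_diff P n x)).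

Definition is_betti X (b : nat -> nat) : Prop :=
  exists P : projective_resolution X, minimal_free P b.

Definition betti_growth X (c : nat) : Prop :=
  exists2 b, is_betti X b &
  exists (alpha : Rdefinitions.R) (n0 : nat), forall n, (n0 <= n)%N ->
    (b n)%:R <= alpha * n%:R ^ (c%:Z - 1).

Definition is_complexity X (c : nat) : Prop :=
  betti_growth X c /\ forall c', betti_growth X c' -> (c <= c')%N.

(** Every linear f from the (t+1)-st syzygy of X to X represents an element eta
    of Ext^{t+1}(X, X), and every eta has such a representative; K is K_eta. *)
Inductive reducible_complexity : lmodType R -> Prop :=
| rc_finite_pd X n :
    finitely_generated X -> pd_le X n -> reducible_complexity X
| rc_reduce X c (P : projective_resolution X) b t
    (f : {linear syzygy P t.+1 -> X}) K
    (j : {linear X -> K}) (k : {linear P t -> K}) c' d :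
    finitely_generated X ->
    is_complexity X c -> (0 < c)%N ->
    minimal_free P b ->
    pushout f (syzygy_incl P t) j k ->
    is_complexity K c' -> (c' < c)%N ->
    is_depth K d -> is_depth X d ->
    reducible_complexity K ->
    reducible_complexity X.

End Local.

(** The notion is only defined over local rings. *)
Definition has_reducible_complexity (R : comNzRingType) (M : lmodType R) : Prop :=
  exists2 m : set R, local_ring m & reducible_complexity m M.

(** * The homological conditions *)

Section Conditions.
Variables (R : comNzRingType) (M : lmodType R).

Definition auslander_condition : Prop :=
  exists b : nat, forall N : lmodType R, finitely_generated N ->
    Ext_eventually_zero M N -> forall i, (b < i)%N -> Ext_zero M N i.

Definition uniform_auslander_condition : Prop :=
  exists b : nat, forall N : lmodType R, finitely_generated N -> nonzero N ->
    Ext_eventually_zero M N ->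
    (forall i, (b < i)%N -> Ext_zero M N i) /\ ~ Ext_zero M N b.

Definition auslander_reiten : Prop :=
  (forall i, (0 < i)%N -> Ext_zero M (M * R^o)%type i) -> projective M.

Definition generalized_auslander_reiten : Prop :=
  forall n : nat,
    (forall i, (n < i)%N -> Ext_zero M (M * R^o)%type i) -> pd_le M n.

Definition dependence_of_total_reflexivity : Prop :=
  (forall i, (0 < i)%N -> Ext_zero M R^o i) -> totally_reflexive M.

End Conditions.

(* Main.v *)
From HB Require Import structures.
From mathcomp.multinomials Require Import freeg.
Require Import Defs.
From mathcomp Require Import all_boot all_order all_algebra.
From mathcomp Require Import generic_quotient ring_quotient.
From mathcomp Require Import boolp classical_sets.

(** All five conditions reduce to vanishing statements for Ext. Let X be reducible through
    0 -> X -> K -> Z -> 0, where Z is the t-th syzygy of X. Then Ext^i(Z, N) = Ext^(i+t)(X, N)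
    for i > 0, so the long exact sequence shows that if Ext^i(X, N) vanishes for large i, then
    an exact bound b on the nonvanishing degrees of K is also one for X. For modules of finite
    projective dimension b is that dimension, by Nakayama and minimal presentations. The case
    b = 0 needs that Ext^*(X, N) is never zero for nonzero X and N: divide N by regular elements
    of the maximal ideal until none is left; then N contains a copy of the residue field, onto
    which X maps.

    If Ext^i(M, M + R) vanishes for large i, then so does Ext^i(M, Y) for every syzygy Y of M,
    and a vanishing Ext^(b+1)(M, Y) splits the b-th syzygy off a projective module. For total
    reflexivity, a diagram chase with the bidual of 0 -> X -> K -> Z -> 0 makes X reflexive, and
    the dual sequence computes Ext^(s+1)(X*, R) from Ext^s(Z*, R). *)

Set Implicit Arguments.
Unset Strict Implicit.
Unset Printing Implicit Defensive.

Import GRing.Theory.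
Local Open Scope classical_set_scope.
Local Open Scope ring_scope.

(* [vector] declares another [span]. *)
Local Notation span := Defs.span.

(** * Short exact sequences and projective modules *)

Section LinearMaps.
Variable R : comNzRingType.
Implicit Types A B C D N P Q U V W : lmodType R.

Lemma linear_fun_exists U V (f : U -> V) :
  linear f -> exists h : {linear U -> V}, forall x, h x = f x.
Proof.
move=> lf; pose m := GRing.isLinear.Build R U V *:%R f lf.
pose h : {linear U -> V} := HB.pack f m.
by exists h.
Qed.

Definition short_exact A B C (f : {linear A -> B}) (g : {linear B -> C}) :=
  [/\ injective f, exact f g & surjective_map g].

Lemma short_exact_comp0 A B C (f : {linear A -> B}) (g : {linear B -> C}) :
  short_exact f g -> forall a, g (f a) = 0.
Proof. by case=> _ ex _ a; apply/(ex (f a)); exists a. Qed.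

Lemma linear_injP A B (f : {linear A -> B}) :
  (forall a, f a = 0 -> a = 0) -> injective f.
Proof.
by move=> f0 x y e; apply/eqP; rewrite -subr_eq0; apply/eqP/f0; rewrite linearB e subrr.
Qed.

Lemma exact_lift A B C D (f : {linear A -> B}) (g : {linear B -> C})
    (phi : {linear D -> B}) :
  injective f -> exact f g -> (forall x, g (phi x) = 0) ->
  exists psi : {linear D -> A}, forall x, f (psi x) = phi x.
Proof.
move=> finj ex gphi.
have /choice[h hP] : forall x, exists a, f a = phi x.
  by move=> x; apply/(ex (phi x)).
have [|psi psiP] := @linear_fun_exists D A h.
  by move=> a x y; apply: finj; rewrite linearP !hP linearP.
by exists psi => x; rewrite psiP hP.
Qed.

Lemma surjective_factor B C D (g : {linear B -> C}) (phi : {linear B -> D}) :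
  surjective_map g -> (forall x, g x = 0 -> phi x = 0) ->
  exists psi : {linear C -> D}, forall x, psi (g x) = phi x.
Proof.
move=> gsurj gphi; have [h hP] := choice gsurj.
have eqphi x y : g x = g y -> phi x = phi y.
  move=> e; apply/eqP; rewrite -subr_eq0; apply/eqP.
  by rewrite -linearB; apply: gphi; rewrite linearB e subrr.
have [|psi psiP] := @linear_fun_exists C D (phi \o h).
  by move=> a x y /=; rewrite -linearP; apply: eqphi; rewrite linearP !hP.
by exists psi => x; rewrite psiP /=; apply: eqphi.
Qed.

Lemma short_exact_kernel B C (g : {linear B -> C}) :
  surjective_map g -> short_exact (kernel_incl g) g.
Proof.
move=> gsurj; split=> // [|y]; first exact: val_inj.
split=> [gy|[x <-]]; last exact: (eqP (kernel_valP x)).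
by have yk : y \in kernel_pred g by [apply/eqP]; exists (Kernel yk).
Qed.

(** The universal property is encoded elementwise: compatible pairs have a preimage, and only 0 maps
    to 0 on both sides. [pullback_lift] recovers the factorization of maps. *)
Definition pullback B C P Q (g : {linear B -> C}) (p : {linear P -> C})
    (q1 : {linear Q -> B}) (q2 : {linear Q -> P}) :=
  [/\ forall z, g (q1 z) = p (q2 z),
      forall b x, g b = p x -> exists2 z, q1 z = b & q2 z = x &
      forall z, q1 z = 0 -> q2 z = 0 -> z = 0].

Lemma pullback_sym B C P Q (g : {linear B -> C}) (p : {linear P -> C})
    (q1 : {linear Q -> B}) (q2 : {linear Q -> P}) :
  pullback g p q1 q2 -> pullback p g q2 q1.
Proof.
case=> c e i; split=> [z|x b h|z h1 h2]; [by rewrite c| |exact: i].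
by have [z] := e b x (esym h); exists z.
Qed.

Lemma pullback_exists B C P (g : {linear B -> C}) (p : {linear P -> C}) :
  exists Q (q1 : {linear Q -> B}) (q2 : {linear Q -> P}), pullback g p q1 q2.
Proof.
pose d : {linear (B * P)%type -> C} := (g \o fst) \- (p \o snd).
exists (kernel d : lmodType R), (fst \o kernel_incl d : {linear _ -> _}),
  (snd \o kernel_incl d : {linear _ -> _}); split=> [z|b x e|z] /=.
- by have /eqP/subr0_eq := kernel_valP z.
- have k : (b, x) \in kernel_pred d by apply/eqP; rewrite /= e subrr.
  by exists (Kernel k).
- by move=> z1 z2; apply: val_inj; rewrite /= [LHS]surjective_pairing z1 z2.
Qed.

Lemma pullback_lift B C P Q D (g : {linear B -> C}) (p : {linear P -> C})
    (q1 : {linear Q -> B}) (q2 : {linear Q -> P})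
    (u : {linear D -> B}) (v : {linear D -> P}) :
  pullback g p q1 q2 -> (forall x, g (u x) = p (v x)) ->
  exists w : {linear D -> Q}, forall x, q1 (w x) = u x /\ q2 (w x) = v x.
Proof.
case=> c e i h.
have /choice[w wP] : forall x, exists z, q1 z = u x /\ q2 z = v x.
  by move=> x; have [z ? ?] := e _ _ (h x); exists z.
have [|w' w'P] := @linear_fun_exists D Q w.
  move=> a x y; apply/eqP; rewrite -subr_eq0; apply/eqP.
  apply: i; first by rewrite linearB linearP !(wP _).1 linearP subrr.
  by rewrite linearB linearP !(wP _).2 linearP subrr.
by exists w' => x; rewrite w'P.
Qed.

Lemma pullback_short_exact A B C P Q (f : {linear A -> B}) (g : {linear B -> C})
    (p : {linear P -> C}) (q1 : {linear Q -> B}) (q2 : {linear Q -> P}) :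
  short_exact f g -> pullback g p q1 q2 ->
  exists2 f' : {linear A -> Q}, short_exact f' q2 & forall a, q1 (f' a) = f a.
Proof.
move=> S pb; have [finj ex gsurj] := S; have [c e i] := pb.
have [|f' f'P] := @pullback_lift B C P Q A g p q1 q2 f \0 pb.
  by move=> a; rewrite (short_exact_comp0 S) linear0.
exists f' => [|a]; last exact: (f'P a).1.
split=> [|z|x].
- by move=> a b /(congr1 q1); rewrite !(f'P _).1 => /finj.
- split=> [z2|[a <-]]; last exact: (f'P a).2.
  have /ex [a fa] : g (q1 z) = 0 by rewrite c z2 linear0.
  exists a; apply/eqP; rewrite -subr_eq0; apply/eqP; apply: i.
    by rewrite linearB (f'P a).1 fa subrr.
  by rewrite linearB (f'P a).2 z2 subrr.
- by have [b gb] := gsurj (p x); have [z _ zx] := e _ _ gb; exists z.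
Qed.

(** A module P that covers B also covers C; the new kernel W is the preimage of A in P, an extension
    of A by U. *)
Lemma short_exact_compose U P A B C (f0 : {linear U -> P}) (g0 : {linear P -> B})
    (f : {linear A -> B}) (g : {linear B -> C}) :
  short_exact f0 g0 -> short_exact f g ->
  exists W (k : {linear W -> P}) (u : {linear U -> W}) (v : {linear W -> A}),
    short_exact k (g \o g0 : {linear P -> C}) /\ short_exact u v.
Proof.
move=> S0 S; have [f0inj ex0 g0surj] := S0; have [finj ex gsurj] := S.
pose gg : {linear P -> C} := g \o g0.
have Sk : short_exact (kernel_incl gg) gg.
  apply: short_exact_kernel => c; have [b <-] := gsurj c.
  by have [x <-] := g0surj b; exists x.
have [kinj kex _] := Sk.
have [x|u uP] := exact_lift (phi := f0) kinj kex.
  by rewrite /= (short_exact_comp0 S0) linear0.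
have [|v vP] := exact_lift (phi := g0 \o kernel_incl gg : {linear _ -> _}) finj ex.
  exact: (short_exact_comp0 Sk).
exists (kernel gg : lmodType R), (kernel_incl gg), u, v; split=> //; split.
- by move=> x y /(congr1 (kernel_incl gg)); rewrite !uP => /f0inj.
- move=> w; split=> [vw|[x <-]].
    have /ex0 [x fx] : g0 (kernel_incl gg w) = 0 by rewrite -[LHS]vP vw linear0.
    by exists x; apply: kinj; rewrite uP.
  apply: finj; rewrite vP linear0; have := short_exact_comp0 S0 x.
  by rewrite -uP.
- move=> a; have [x gx] := g0surj (f a).
  have /kex [w wx] : gg x = 0 by rewrite /= gx (short_exact_comp0 S).
  by exists w; apply: finj; rewrite vP -gx -wx.
Qed.

(** * Direct summands, projective modules and free covers *)

Definition retract A B :=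
  exists (i : {linear A -> B}) (r : {linear B -> A}), forall x, r (i x) = x.

Lemma projective_retract A P : projective P -> retract A P -> projective A.
Proof.
move=> prP [i [r ri]] U V g f gsurj.
have [h hP] := prP U V g (f \o r : {linear P -> V}) gsurj.
by exists (h \o i : {linear A -> U}) => x /=; rewrite hP /= ri.
Qed.

Lemma projective_prod P Q : projective P -> projective Q -> projective (P * Q)%type.
Proof.
move=> prP prQ U V g f gsurj.
have [|f1 f1E] := @linear_fun_exists P V (fun x => f (x, 0)).
  by move=> a x y; rewrite -linearP; congr (f (_, _)); rewrite /= scaler0 addr0.
have [|f2 f2E] := @linear_fun_exists Q V (fun y => f (0, y)).
  by move=> a x y; rewrite -linearP; congr (f (_, _)); rewrite /= scaler0 addr0.
have [h1 h1E] := prP U V g f1 gsurj; have [h2 h2E] := prQ U V g f2 gsurj.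
exists ((h1 \o fst) \+ (h2 \o snd) : {linear (P * Q)%type -> U}) => -[x y] /=.
rewrite linearD h1E h2E f1E f2E -linearD; congr (f (_, _)); first by rewrite /= addr0.
by rewrite /= add0r.
Qed.

Lemma fglift_linear (K : choiceType) V (f : K -> V) :
  linear (fglift f : {freeg K / R} -> V).
Proof.
have add := @lift_is_additive R K V f.
have addD x y : fglift f (x + y) = fglift f x + fglift f y.
  have e0 : fglift f 0 = 0 by rewrite -[in LHS](subrr 0) add subrr.
  by rewrite -{1}[y]opprK add -[- y]add0r add e0 sub0r opprK.
have add_sum (s : seq K) (F : K -> {freeg K / R}) :
    fglift f (\sum_(i <- s) F i) = \sum_(i <- s) fglift f (F i).
  elim: s => [|k s IH]; last by rewrite !big_cons addD IH.
  by rewrite !big_nil -[in LHS](subrr 0) add subrr.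
move=> a x y; rewrite addD; congr (_ + _).
rewrite -[in RHS](freeg_sumE x) [a *: x]/(fgscale a x) /fgscale !add_sum scaler_sumr.
by apply: eq_bigr => i _; rewrite !liftU scalerA.
Qed.

(** The cover is the free module on the underlying set of C. A map out of it is lifted by choosing
    preimages of the images of the basis elements. *)
Lemma enough_projectives C :
  exists P (g : {linear P -> C}), projective P /\ surjective_map g.
Proof.
have [|g gE] := @linear_fun_exists {freeg C / R} C (fglift id).
  exact: fglift_linear.
exists ({freeg C / R} : lmodType R), g; split=> [U V p f psurj|c]; last first.
  by exists << c >>; rewrite gE liftU scale1r.
have [s sP] := choice psurj.
have [|h hE] := @linear_fun_exists {freeg C / R} U (fglift (fun c => s (f << c >>))).
  exact: fglift_linear.
exists h => x; rewrite -(freeg_sumE x) !linear_sum; apply: eq_bigr => c _.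
have -> : << coeff c x *g c >> = coeff c x *: << c >> :> {freeg C / R}.
  by apply/eqP/freeg_eqP => z; rewrite coeffZ !coeffU mul1r.
by rewrite !linearZ /= hE liftU scale1r sP.
Qed.

Lemma projective_presentation C :
  exists A P (f : {linear A -> P}) (g : {linear P -> C}),
    short_exact f g /\ projective P.
Proof.
have [P [g [prP gsurj]]] := enough_projectives C.
by exists (kernel g : lmodType R), P, (kernel_incl g), g; split=> //; apply: short_exact_kernel.
Qed.

End LinearMaps.

(** * Vanishing of Ext *)

Section Vanishing.
Variable R : comNzRingType.
Implicit Types A B C D N P Q S T U V W : lmodType R.

(** This says that Ext^1(C, N) = 0 without a projective cover: by pushing out along [phi], the
    extension property amounts to the splitting of all extensions of C by N. *)
Definition ext1_vanishes N C :=
  forall A B (f : {linear A -> B}) (g : {linear B -> C}), short_exact f g ->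
  forall phi : {linear A -> N}, exists psi : {linear B -> N}, forall a, psi (f a) = phi a.

(* Ext^i(C, N) = 0, by dimension shifting along every projective presentation
   of [C]; the definition makes no reference to a chosen resolution. *)
Fixpoint ext_vanishes N (i : nat) C : Prop :=
  match i with
  | 0 => forall (phi : {linear C -> N}) x, phi x = 0
  | 1 => ext1_vanishes N C
  | i'.+1 => forall A P (f : {linear A -> P}) (g : {linear P -> C}),
      short_exact f g -> projective P -> ext_vanishes N i' A
  end.

(** Pull the extension T of W back along V -> W. The map extends to the pullback Q because Ext^1(V,
    N) = 0; subtracting a map that factors through V makes it vanish on U, so it descends to T. *)
Lemma ext1_of_short_exact N U V W (f : {linear U -> V}) (g : {linear V -> W}) :
  short_exact f g -> ext1_vanishes N V ->
  (forall phi : {linear U -> N}, exists psi : {linear V -> N}, forall a, psi (f a) = phi a) ->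
  ext1_vanishes N W.
Proof.
move=> S0 V0 ext S T s t S1 phi.
have [Q [q1 [q2 pb]]] := pullback_exists t g.
have [s' S' s'E] := pullback_short_exact S1 pb.
have [f' F' f'E] := pullback_short_exact S0 (pullback_sym pb).
have [psi psiE] := V0 _ _ _ _ S' phi.
have [psi' psi'E] := ext (psi \o f' : {linear U -> N}).
have [_ ex q1surj] := F'.
have [z /ex [u <-]|chi chiE] :=
    surjective_factor (phi := psi \- (psi' \o q2) : {linear Q -> N}) q1surj.
  by rewrite /= f'E psi'E /= subrr.
exists chi => a; rewrite -s'E chiE /= psiE (short_exact_comp0 S') linear0.
by rewrite subr0.
Qed.

(** The map is extended in two stages: first to the preimage Q of A in T, an extension of A, and
    then from Q to T, whose quotient by Q is C. *)
Lemma ext1_middle N A B C (f : {linear A -> B}) (g : {linear B -> C}) :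
  short_exact f g -> ext1_vanishes N A -> ext1_vanishes N C -> ext1_vanishes N B.
Proof.
move=> S0 A0 C0 S T s t S1 phi; have [finj fex gsurj] := S0.
have [Q [q1 [q2 pb]]] := pullback_exists t f.
have [s' S' s'E] := pullback_short_exact S1 pb.
have [psi psiE] := A0 _ _ _ _ S' phi; have [c e i] := pb.
have Sq : short_exact q1 (g \o t : {linear T -> C}).
  split=> [|y|z].
  - apply: linear_injP => z z0; apply: i => //; apply: finj.
    by rewrite -c z0 !linear0.
  - split=> [/fex [a fa]|[z <-] /=]; last by rewrite c (short_exact_comp0 S0).
    by have [z] := e _ _ (esym fa); exists z.
  - have [b <-] := gsurj z; case: S1 => _ _ tsurj; have [y <-] := tsurj b.
    by exists y.
have [chi chiE] := C0 _ _ _ _ Sq psi.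
by exists chi => a; rewrite -s'E chiE psiE.
Qed.

(** Pull the extension T of A back along the retraction Q -> A; the inclusion of A in Q yields a
    section [w] of the projection from the pullback to T. *)
Lemma ext1_retract N A Q : retract A Q -> ext1_vanishes N Q -> ext1_vanishes N A.
Proof.
move=> [i [r ri]] Q0 S T s t S1 phi.
have [Z [q1 [q2 pb]]] := pullback_exists t r.
have [s' S' s'E] := pullback_short_exact S1 pb.
have [psi psiE] := Q0 _ _ _ _ S' phi.
have [|w wE] := pullback_lift (u := idfun : {linear T -> T}) (v := i \o t : {linear T -> Q}) pb.
  by move=> x /=; rewrite ri.
exists (psi \o w : {linear T -> N}) => a /=; rewrite -psiE; congr (psi _).
have [_ _ inj] := pb; apply/eqP; rewrite -subr_eq0; apply/eqP; apply: inj.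
  by rewrite linearB (wE _).1 s'E subrr.
rewrite linearB (wE _).2 /= (short_exact_comp0 S1) (short_exact_comp0 S').
by rewrite linear0 subrr.
Qed.

Lemma projective_retraction A B P (f : {linear A -> B}) (g : {linear B -> P}) :
  short_exact f g -> projective P -> exists rho : {linear B -> A}, forall a, rho (f a) = a.
Proof.
move=> S prP; have [finj fex gsurj] := S.
have [h hE] := prP _ _ g (idfun : {linear P -> P}) gsurj.
have [y|rho rhoE] := exact_lift (phi := idfun \- (h \o g) : {linear B -> B}) finj fex.
  by rewrite linearB /= hE /= subrr.
exists rho => a; apply: finj.
by rewrite rhoE /= (short_exact_comp0 S) linear0 subr0.
Qed.

Lemma split_projective A B P (f : {linear A -> B}) (g : {linear B -> P}) :
  short_exact f g -> projective P -> retract A B.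
Proof. by move=> S prP; have [rho rhoE] := projective_retraction S prP; exists f, rho. Qed.

Lemma ext1_projective N P : projective P -> ext1_vanishes N P.
Proof.
move=> prP A B f g S phi; have [rho rhoE] := projective_retraction S prP.
by exists (phi \o rho : {linear B -> N}) => a /=; rewrite rhoE.
Qed.

Lemma ext_retract N i A Q : retract A Q -> ext_vanishes N i.+1 Q -> ext_vanishes N i.+1 A.
Proof.
elim: i A Q => [|i IH] A Q ret; first exact: ext1_retract.
move=> Q0 U P f g S prP; have [j [r rj]] := ret; have [finj fex gsurj] := S.
have [P1 [h [prP1 hsurj]]] := enough_projectives Q.
(* Adding P to a cover of Q lets U embed in the kernel of d by u |-> (f u, 0). The map [pr] below
   leads back to U, because g o pr = r o d. *)
pose d : {linear (P * P1)%type -> Q} := (j \o g \o fst) \+ (h \o snd).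
have dsurj : surjective_map d.
  by move=> x; have [y yx] := hsurj x; exists (0, y); rewrite /= !linear0 add0r.
have Sk := short_exact_kernel dsurj; have [kinj kex _] := Sk.
have W0 := Q0 _ _ _ _ Sk (projective_prod prP prP1).
apply: IH W0.
have [s sE] := prP1 _ _ g (r \o h : {linear P1 -> A}) gsurj.
have [|fu fuE] := @linear_fun_exists R U (P * P1)%type (fun u => (f u, 0)).
  by move=> a x y; rewrite linearP; congr pair; rewrite /= scaler0 addr0.
have [u|u uE] := exact_lift (phi := fu) kinj kex.
  by rewrite fuE /= (short_exact_comp0 S) !linear0 addr0.
pose pr : {linear (P * P1)%type -> P} := fst \+ (s \o snd).
have [w|v vE] := exact_lift (phi := pr \o kernel_incl d : {linear _ -> _}) finj fex.
  have /(congr1 r) := short_exact_comp0 Sk w.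
  by rewrite /= linearD rj linear0 linearD sE.
exists u, v => x; apply: finj; rewrite vE.
by have := congr1 pr (uE x); rewrite fuE /= linear0 addr0.
Qed.

Lemma ext_projective N i P : projective P -> ext_vanishes N i.+1 P.
Proof.
elim: i P => [|i IH] P prP; first exact: ext1_projective.
move=> A Q f g S prQ; apply: IH; apply: projective_retract prQ _.
exact: split_projective S prP.
Qed.

(** Let Q be the pullback of B and a projective cover P of C. Seen over P it splits, so A is a
    summand of Q; seen over B it is an extension of B by the syzygy of C. The middle term property
    is a hypothesis in degree i + 1 so that the induction proving it can call this lemma. *)
Lemma ext_left_of_middle N i :
  (forall A B C (f : {linear A -> B}) (g : {linear B -> C}), short_exact f g ->
     ext_vanishes N i.+1 A -> ext_vanishes N i.+1 C -> ext_vanishes N i.+1 B) ->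
  forall A B C (f : {linear A -> B}) (g : {linear B -> C}), short_exact f g ->
     ext_vanishes N i.+1 B -> ext_vanishes N i.+2 C -> ext_vanishes N i.+1 A.
Proof.
move=> mid A B C f g S B0 C0.
have [Z [P [z [p [Sz prP]]]]] := projective_presentation C.
have [Q [q1 [q2 pb]]] := pullback_exists g p.
have [f' F' _] := pullback_short_exact S pb.
have [z' Z' _] := pullback_short_exact Sz (pullback_sym pb).
apply: ext_retract (split_projective F' prP) _.
exact: mid Z' (C0 _ _ _ _ Sz prP) B0.
Qed.

(** In the inductive step a cover of B is used as a cover of C too: its kernel W over C is an
    extension of A by the syzygy U of B, and vanishing passes from W and A to U one degree lower. *)
Lemma ext_middle N i A B C (f : {linear A -> B}) (g : {linear B -> C}) :
  short_exact f g ->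
  ext_vanishes N i.+1 A -> ext_vanishes N i.+1 C -> ext_vanishes N i.+1 B.
Proof.
elim: i A B C f g => [|i IH] A B C f g S; first exact: (ext1_middle S).
move=> A0 C0 U P f0 g0 S0 prP.
have [W [k [u [v [Sk Su]]]]] := short_exact_compose S0 S.
exact: ext_left_of_middle Su (C0 _ _ _ _ Sk prP) A0.
Qed.

Lemma ext_left N i A B C (f : {linear A -> B}) (g : {linear B -> C}) :
  short_exact f g ->
  ext_vanishes N i.+1 B -> ext_vanishes N i.+2 C -> ext_vanishes N i.+1 A.
Proof. by apply: ext_left_of_middle; apply: ext_middle. Qed.

(** This is independence of the presentation, by Schanuel's argument: the pullback of two covers of
    C contains one syzygy as a summand and is an extension of a projective module by the other. *)
Lemma ext_shift N i A P C (f : {linear A -> P}) (g : {linear P -> C}) :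
  short_exact f g -> projective P ->
  ext_vanishes N i.+2 C <-> ext_vanishes N i.+1 A.
Proof.
move=> S prP; split=> [C0|A0 A' P' f' g' S' prP']; first exact: C0 S prP.
have [Q [q1 [q2 pb]]] := pullback_exists g g'.
have [k K _] := pullback_short_exact S pb.
have [k' K' _] := pullback_short_exact S' (pullback_sym pb).
apply: ext_retract (split_projective K' prP) _.
exact: ext_middle K A0 (ext_projective _ _ prP').
Qed.

Lemma ext_right N i A B C (f : {linear A -> B}) (g : {linear B -> C}) :
  short_exact f g ->
  ext_vanishes N i.+1 A -> ext_vanishes N i.+2 B -> ext_vanishes N i.+2 C.
Proof.
move=> S A0 B0; have [U [P [f0 [g0 [S0 prP]]]]] := projective_presentation B.
have [W [k [u [v [Sk Su]]]]] := short_exact_compose S0 S.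
by apply/(ext_shift _ _ Sk prP); apply: ext_middle Su (B0 _ _ _ _ S0 prP) A0.
Qed.

(** * The long exact sequence in the second argument *)

Lemma ext1_hom_lift N' N N'' (f : {linear N' -> N}) (g : {linear N -> N''}) C :
  short_exact f g -> ext1_vanishes N' C ->
  forall phi : {linear C -> N''}, exists psi : {linear C -> N}, forall x, g (psi x) = phi x.
Proof.
move=> S C0 phi; have [finj fex gsurj] := S.
have [Q [q1 [q2 pb]]] := pullback_exists g phi.
have [f' F' f'E] := pullback_short_exact S pb.
(* Extending the identity of N' splits the extension pulled back along [phi]; the section, composed
   with the projection to N, is the lift. *)
have [rho rhoE] := C0 _ _ _ _ F' (idfun : {linear N' -> N'}).
have [_ F'ex q2surj] := F'; have [c _ _] := pb.
have [z z0|psi psiE] := surjective_factor (phi := q1 \- (f \o rho) : {linear Q -> N}) q2surj.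
  by have /F'ex [a <-] := z0; rewrite /= f'E rhoE subrr.
exists psi => x; have [z <-] := q2surj x.
by rewrite psiE /= linearB (short_exact_comp0 S) subr0 c.
Qed.

Lemma ext_second_right N' N N'' (f : {linear N' -> N}) (g : {linear N -> N''}) i C :
  short_exact f g ->
  ext_vanishes N i C -> ext_vanishes N' i.+1 C -> ext_vanishes N'' i C.
Proof.
move=> S; have [_ _ gsurj] := S.
elim: i C => [|[|i] IH] C C0 C1.
- by move=> phi x; have [psi <-] := ext1_hom_lift S C1 phi; rewrite C0 linear0.
- have [A [P [s [t [S0 prP]]]]] := projective_presentation C.
  change (ext1_vanishes N'' C).
  apply: (ext1_of_short_exact S0 (ext1_projective prP)) => phi.
  have A1 : ext1_vanishes N' A by apply: (C1 _ _ _ _ S0 prP).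
  have [psi psiE] := ext1_hom_lift S A1 phi.
  have [chi chiE] := C0 _ _ _ _ S0 psi.
  by exists (g \o chi : {linear P -> N''}) => a; rewrite /= chiE psiE.
- move=> A P s t S0 prP; apply: IH; [exact: C0 S0 prP|exact: C1 S0 prP].
Qed.

Lemma ext_second_left N' N N'' (f : {linear N' -> N}) (g : {linear N -> N''}) i C :
  short_exact f g ->
  ext_vanishes N'' i.+1 C -> ext_vanishes N i.+2 C -> ext_vanishes N' i.+2 C.
Proof.
move=> S; have [finj fex gsurj] := S.
elim: i C => [|i IH] C C0 C1 A P s t S0 prP; last first.
  by apply: IH; [exact: C0 S0 prP|exact: C1 S0 prP].
have A1 : ext1_vanishes N A by apply: C1 S0 prP.
have [A2 [P2 [s2 [t2 [S2 prP2]]]]] := projective_presentation A.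
change (ext1_vanishes N' A).
(* Extend f o phi to psi : P2 -> N. Its image in N'' induces a map on A, which extends to P because
   Ext^1(C, N'') = 0 and then lifts to N. Subtracting this lift from psi gives values in N' without
   changing the restriction to A2. *)
apply: (ext1_of_short_exact S2 (ext1_projective prP2)) => phi.
have [psi psiE] := A1 _ _ _ _ S2 (f \o phi : {linear A2 -> N}).
have [_ t2ex t2surj] := S2.
have [x /t2ex [a <-]|chi chiE] := surjective_factor (phi := g \o psi : {linear P2 -> N''}) t2surj.
  by rewrite /= psiE /= (short_exact_comp0 S).
have [theta thetaE] := C0 _ _ _ _ S0 chi.
have [theta' theta'E] := prP _ _ g theta gsurj.
have [x|rho rhoE] :=
    exact_lift (phi := psi \- (theta' \o s \o t2) : {linear P2 -> N}) finj fex.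
  by rewrite linearB /= theta'E thetaE chiE /= subrr.
exists rho => a; apply: finj; rewrite rhoE /= psiE (short_exact_comp0 S2).
by rewrite !linear0 addr0.
Qed.

Lemma ext_second_retract N N' i C : retract N' N -> ext_vanishes N i C -> ext_vanishes N' i C.
Proof.
move=> [j [r rj]]; elim: i C => [|[|i] IH] C C0.
- move=> phi x; rewrite -[LHS]rj; have := C0 (j \o phi : {linear C -> N}) x.
  by move=> /= ->; rewrite linear0.
- move=> A B f g S phi; have [psi psiE] := C0 _ _ _ _ S (j \o phi : {linear A -> N}).
  by exists (r \o psi : {linear B -> N'}) => a; rewrite /= psiE /= rj.
- by move=> A P f g S prP; apply: IH; apply: C0 S prP.
Qed.

Lemma ext_second_prod N N' i C :
  ext_vanishes N i C -> ext_vanishes N' i C -> ext_vanishes (N * N')%type i C.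
Proof.
elim: i C => [|[|i] IH] C C0 C1.
- move=> phi x; rewrite [LHS]surjective_pairing.
  by rewrite [(phi x).1](C0 (fst \o phi : {linear _ -> _}) x) [(phi x).2](C1 (snd \o phi : {linear _ -> _}) x).
- move=> A B f g S phi.
  have [p1 p1E] := C0 _ _ _ _ S (fst \o phi : {linear _ -> _}).
  have [p2 p2E] := C1 _ _ _ _ S (snd \o phi : {linear _ -> _}).
  have [|psi psiE] := @linear_fun_exists R B (N * N')%type (fun b => (p1 b, p2 b)).
    by move=> a x y; rewrite !linearP.
  by exists psi => a; rewrite psiE p1E p2E /= -surjective_pairing.
- by move=> A P f g S prP; apply: IH; [exact: C0 S prP|exact: C1 S prP].
Qed.

End Vanishing.

(** * Resolutions *)

Section Resolutions.
Variable R : comNzRingType.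
Implicit Types A C M N P X : lmodType R.

(** The data are packed into a record in [Type], so that one chosen presentation per module can be
    iterated into a resolution. S is the class of the syzygies and Q that of the projective
    terms. *)
Record presentation_in (S Q : lmodType R -> Prop) C := PresentationIn {
  pres_ker : lmodType R;
  pres_obj : lmodType R;
  pres_incl : {linear pres_ker -> pres_obj};
  pres_proj : {linear pres_obj -> C};
  pres_exact : short_exact pres_incl pres_proj;
  pres_projective : projective pres_obj;
  pres_kerP : S pres_ker;
  pres_objP : Q pres_obj
}.

Lemma resolution_exists (S Q : lmodType R -> Prop) M :
  (forall C, S C -> exists A P (f : {linear A -> P}) (g : {linear P -> C}),
     [/\ short_exact f g, projective P, S A & Q P]) ->
  S M -> exists P : projective_resolution M, forall n, Q (P n).
Proof.
move=> step SM.
have pres (s : {C | S C}) : presentation_in S Q (sval s).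
  have /cid[A /cid[P /cid[f /cid[g [fg prP SA QP]]]]] := step _ (svalP s).
  exact: PresentationIn fg prP SA QP.
pose next (s : {C | S C}) : {C | S C} := exist S _ (pres_kerP (pres s)).
pose st n := iter n next (exist S M SM).
pose obj n := pres_obj (pres (st n)).
pose d n : {linear obj n.+1 -> obj n} :=
  pres_incl (pres (st n)) \o pres_proj (pres (st n.+1)).
have ex n : short_exact (pres_incl (pres (st n))) (pres_proj (pres (st n))).
  exact: pres_exact.
unshelve eexists (@ProjectiveResolution R M obj d (pres_proj (pres (st 0))) _ _ _ _).
- by move=> n; apply: pres_projective.
- by case: (ex 0).
- move=> y; have [_ e0 _] := ex 0; have [_ _ s1] := ex 1.
  split=> [/e0 [a <-]|[x <-]]; last exact: (short_exact_comp0 (ex 0)).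
  by have [x <-] := s1 a; exists x.
- move=> n y; have [_ e1 _] := ex n.+1; have [_ _ s2] := ex n.+2.
  have [inj0 _ _] := ex n; split=> [e|[x <-]].
    have /e1[a <-] : pres_proj (pres (st n.+1)) y = 0.
      by apply: inj0; rewrite linear0 -[RHS]e.
    by have [x <-] := s2 a; exists x.
  by rewrite /d /= (short_exact_comp0 (ex n.+1)) linear0.
- by move=> n; apply: pres_objP.
Qed.

Lemma projective_resolution_exists M : exists P : projective_resolution M, True.
Proof.
have [//|//|P _] := @resolution_exists (fun=> True) (fun=> True) M; last by exists P.
move=> C _; have [A [P [f [g [S prP]]]]] := projective_presentation C.
by exists A, P, f, g.
Qed.

Lemma syzygy_presentationS M (P : projective_resolution M) k :
  exists2 g : {linear P k.+1 -> syzygy P k.+1}, short_exact (syzygy_incl P k.+1) g &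
    forall x, syzygy_incl P k (g x) = res_diff P k x.
Proof.
have kk : exact (res_diff P k) (aug_diff P k).
  by case: k => [|k]; [apply: res_exact0|apply: res_exactS].
have kex : exact (kernel_incl (aug_diff P k)) (aug_diff P k).
  move=> y; split=> [gy|[x <-]]; last exact: (eqP (kernel_valP x)).
  by have yk : y \in kernel_pred (aug_diff P k) by [apply/eqP]; exists (Kernel yk).
have [x|g gE] := exact_lift (phi := res_diff P k) val_inj kex.
  by apply/kk; exists x.
exists g => //; split; first exact: val_inj.
- move=> y; split=> [gy|[x <-]].
    have yk : y \in kernel_pred (aug_diff P k.+1).
      by apply/eqP; rewrite /= -gE gy linear0.
    by exists (Kernel yk).
  by apply: val_inj; apply: etrans (gE _) _; apply: (eqP (kernel_valP x)).
- move=> y; have /kk [x xE] := eqP (kernel_valP y).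
  by exists x; apply: val_inj; apply: etrans (gE _) _.
Qed.

Lemma syzygy_presentation M (P : projective_resolution M) k :
  exists g : {linear P k -> syzygy P k}, short_exact (syzygy_incl P k) g.
Proof.
case: k => [|k]; last by have [g S _] := syzygy_presentationS P k; exists g.
by exists (res_aug P); apply: short_exact_kernel; apply: res_aug_surj.
Qed.

Lemma ext_syzygy M N (P : projective_resolution M) i k :
  ext_vanishes N i.+1 (syzygy P k) <-> ext_vanishes N (i + k).+1 M.
Proof.
elim: k i => [|k IH] i; first by rewrite addn0.
have [g S] := syzygy_presentation P k.
have e := ext_shift N i S (@res_projective _ _ P k).
by rewrite addnS -addSn -IH; apply: iff_sym.
Qed.

Lemma ext1_of_presentation N C A P (f : {linear A -> P}) (g : {linear P -> C}) :
  short_exact f g -> projective P ->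
  ext1_vanishes N C <->
  forall phi : {linear A -> N}, exists psi : {linear P -> N}, forall a, psi (f a) = phi a.
Proof.
move=> S prP; split; first by move=> C0; apply: C0 S.
exact: (ext1_of_short_exact S (ext1_projective prP)).
Qed.

(** A cocycle in degree i + 1 is a map on the syzygy of index i + 1, and it is a coboundary when
    that map extends to P_i. As one side of the equivalence does not mention P, vanishing is the
    same for all resolutions. *)
Lemma ext_vanishes_resolution M N (P : projective_resolution M) i :
  ext_vanishes N i M <->
  forall phi : {linear P i -> N}, cocycle phi -> coboundary phi.
Proof.
case: i => [|i].
  split=> [M0 phi c|h phi x].
    have [x /res_exact0 [y <-]|psi psiE] := surjective_factor (phi := phi) (@res_aug_surj _ _ P).
      exact: c.
    by move=> x; rewrite -psiE; apply: M0.
  have [y <-] := @res_aug_surj _ _ P x.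
  apply: (h (phi \o res_aug P : {linear P 0 -> N})) => z.
  by rewrite /= (_ : res_aug P _ = 0) ?linear0 //; apply/res_exact0; exists z.
rewrite -[i in ext_vanishes _ i.+1]add0n -(ext_syzygy N P).
have [g S] := syzygy_presentation P i; have [g1 [_ ex1 g1surj] g1E] := syzygy_presentationS P i.
apply: (iff_trans (ext1_of_presentation N S (@res_projective _ _ P i))); split=> ext phi.
- move=> c; have [x g1x|psi psiE] := surjective_factor (phi := phi) g1surj.
    have /res_exactS [y <-] : res_diff P i x = 0 by rewrite -g1E g1x linear0.
    exact: c.
  have [chi chiE] := ext psi.
  by exists chi => x; rewrite -psiE -chiE g1E.
- have [|psi psiE] := ext (phi \o g1 : {linear P i.+1 -> N}).
    move=> x /=; rewrite (_ : g1 _ = 0) ?linear0 //; apply: val_inj.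
    by apply: etrans (g1E _) _; apply/res_exactS; exists x.
  exists psi => a; have [x <-] := g1surj a.
  by rewrite g1E -psiE.
Qed.

Lemma Ext_zeroP M N i : Ext_zero M N i <-> ext_vanishes N i M.
Proof.
split=> [[P h]|h]; first exact/(ext_vanishes_resolution N P).
by have [P _] := projective_resolution_exists M; exists P; apply/ext_vanishes_resolution.
Qed.

Lemma Ext_eventually_zeroP M N :
  Ext_eventually_zero M N <-> exists n, forall i, (n <= i)%N -> ext_vanishes N i M.
Proof. by split=> -[n h]; exists n => i /h /Ext_zeroP. Qed.

Lemma pd_le_ext M n N : pd_le M n -> ext_vanishes N n.+1 M.
Proof.
move=> [P P0]; apply/(ext_vanishes_resolution N P) => phi _.
by exists \0 => x /=; rewrite (P0 n.+1 _ x) // linear0.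
Qed.

Lemma pd_leW M n k : (n <= k)%N -> pd_le M n -> pd_le M k.
Proof. by move=> nk [P P0]; exists P => i ki; apply: P0; apply: leq_ltn_trans ki. Qed.

(** * Prolonging resolutions and bounding their length *)

Section ConsResolution.
Variables (A P C : lmodType R) (f : {linear A -> P}) (g : {linear P -> C}).
Hypotheses (S : short_exact f g) (prP : projective P) (Q : projective_resolution A).

Definition cons_obj (n : nat) : lmodType R := if n is k.+1 then Q k else P.

Definition cons_diff (n : nat) : {linear cons_obj n.+1 -> cons_obj n} :=
  match n with 0 => f \o res_aug Q | k.+1 => res_diff Q k end.

Lemma cons_resolution : exists P' : projective_resolution C,
  forall i (x : P' i.+1), (forall y : Q i, y = 0) -> x = 0.
Proof.
have [finj fex gsurj] := S.
unshelve eexists (@ProjectiveResolution R C cons_obj cons_diff g _ _ _ _) => //.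
- by case=> [|n]; rewrite /cons_obj //; apply: res_projective.
- move=> y; split=> [/fex [a <-]|[x <-]]; last exact: (short_exact_comp0 S).
  by have [x <-] := @res_aug_surj _ _ Q a; exists x.
- case=> [|n] y; last exact: (@res_exactS R A Q n y).
  split=> [e|[x <-]].
    by apply/res_exact0; apply: finj; rewrite linear0 -[RHS]e.
  by rewrite /= (_ : res_aug Q _ = 0) ?linear0 //; apply/res_exact0; exists x.
Qed.

End ConsResolution.

Lemma pd_le_presentation A P C n (f : {linear A -> P}) (g : {linear P -> C}) :
  short_exact f g -> projective P -> pd_le A n -> pd_le C n.+1.
Proof.
move=> S prP [Q Q0]; have [P' P'0] := cons_resolution S prP Q.
by exists P'; case=> [|i] // ni x; apply: P'0 => y; apply: Q0.
Qed.

Lemma rV0_eq0 (x : 'rV[R]_0) : x = 0.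
Proof. by apply/rowP => -[]. Qed.

Lemma pd_le_projective P : projective P -> pd_le P 0.
Proof.
move=> prP; pose Z : lmodType R := 'rV[R]_0.
have prZ : projective Z.
  by move=> U V g f _; exists \0 => x /=; rewrite [x]rV0_eq0 !linear0.
have ex (V : lmodType R) (h : {linear Z -> V}) : exact (\0 : {linear Z -> Z}) h.
  by move=> y; rewrite [y]rV0_eq0 linear0; split=> // _; exists 0.
have [Q Q0] : exists Q : projective_resolution Z, forall i (y : Q i), y = 0.
  unshelve eexists (@ProjectiveResolution R Z (fun=> Z) (fun=> \0) idfun _ _ _ _) => //.
  - by move=> y; exists y.
  - by move=> i y; rewrite [LHS]rV0_eq0.
have S : short_exact (\0 : {linear Z -> P}) (idfun : {linear P -> P}).
  split=> [x y _|x|x]; [by rewrite [x]rV0_eq0 [y]rV0_eq0| |by exists x].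
  by split=> [/= x0|[y <-] //]; exists 0.
have [P' P'0] := cons_resolution S prP Q.
by exists P'; case=> // i _ x; apply: P'0 => y; apply: Q0.
Qed.

End Resolutions.

(** * Noetherian modules and quotients *)

Section Submodules.
Variable R : comNzRingType.
Implicit Types A B C K L M N P Q W X Y : lmodType R.

Definition submodule M (Z : set M) :=
  Z 0 /\ forall (a : R) x y, Z x -> Z y -> Z (a *: x + y).

Definition fg_set M (Z : set M) := exists s : seq M, Z = span s.

Definition noetherian_module M := forall Z : set M, submodule Z -> fg_set Z.

Lemma submoduleD M (Z : set M) x y : submodule Z -> Z x -> Z y -> Z (x + y).
Proof. by move=> [_ h] Zx Zy; rewrite -[x]scale1r; apply: h. Qed.

Lemma submoduleZ M (Z : set M) a x : submodule Z -> Z x -> Z (a *: x).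
Proof. by move=> [z h] Zx; rewrite -[_ *: _]addr0; apply: h. Qed.

Lemma submoduleB M (Z : set M) x y : submodule Z -> Z x -> Z y -> Z (x - y).
Proof. by move=> h Zx Zy; rewrite -scaleN1r; apply: submoduleD => //; apply: submoduleZ. Qed.

Lemma submodule_range M N (f : {linear M -> N}) : submodule (range f).
Proof.
split=> [|a _ _ [x _ <-] [y _ <-]]; first by exists 0; rewrite ?linear0.
by exists (a *: x + y); rewrite ?linearP.
Qed.

Lemma submodule_preimage M N (f : {linear M -> N}) (Z : set N) :
  submodule Z -> submodule (f @^-1` Z).
Proof.
by move=> [Z0 ZP]; split=> [|a x y fx fy]; rewrite /preimage /= ?linear0 // linearP; apply: ZP.
Qed.

Lemma submodule_image M N (f : {linear M -> N}) (Z : set M) :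
  submodule Z -> submodule (f @` Z).
Proof.
move=> [Z0 ZP]; split=> [|a _ _ [x Zx <-] [y Zy <-]]; first by exists 0; rewrite ?linear0.
by exists (a *: x + y); rewrite ?linearP //; apply: ZP.
Qed.

Lemma span_nil M (x : M) : span [::] x <-> x = 0.
Proof.
split=> [[c ->]|->]; first by rewrite big_ord0.
by exists (fun=> 0); rewrite big_ord0.
Qed.

Lemma span_cons M (a x : M) s :
  span (a :: s) x <-> exists c y, span s y /\ x = c *: a + y.
Proof.
split=> [[c ->]|[c [_ [[d ->] ->]]]].
  exists (c ord0), (\sum_(i < size s) c (lift ord0 i) *: s`_i); split.
    by exists (fun i => c (lift ord0 i)).
  by rewrite big_ord_recl.
exists (fun i => if unlift ord0 i is Some j then d j else c).
by rewrite big_ord_recl unlift_none; congr (_ + _); apply: eq_bigr => i _; rewrite liftK.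
Qed.

Lemma submodule_span M (s : seq M) : submodule (span s).
Proof.
split=> [|a _ _ [c ->] [d ->]].
  by exists (fun=> 0); rewrite big1 // => i _; rewrite scale0r.
exists (fun i => a * c i + d i); rewrite scaler_sumr -big_split /=.
by apply: eq_bigr => i _; rewrite scalerDl scalerA.
Qed.

Lemma span_mem M (s : seq M) x : x \in s -> span s x.
Proof.
elim: s => // a s IH; rewrite inE => /orP[/eqP ->|/IH h]; apply/span_cons.
  exists 1, 0; split; last by rewrite scale1r addr0.
  by case: (submodule_span s).
by exists 0, x; split; rewrite // scale0r add0r.
Qed.

Lemma span_subset M (s : seq M) (Z : set M) :
  submodule Z -> (forall x, x \in s -> Z x) -> span s `<=` Z.
Proof.
move=> [Z0 ZP]; elim: s => [_ x /span_nil -> //|a s IH sZ x /span_cons [c [y [sy ->]]]].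
apply: ZP; first by apply: sZ; rewrite mem_head.
by apply: IH sy => z zs; apply: sZ; rewrite inE zs orbT.
Qed.

Lemma span_map M N (f : {linear M -> N}) (s : seq M) y :
  span (map f s) y <-> exists2 x, span s x & f x = y.
Proof.
elim: s y => [|a s IH] y.
  split=> [/span_nil ->|[x /span_nil -> <-]]; last by apply/span_nil; rewrite linear0.
  by exists 0; rewrite ?linear0 //; apply/span_nil.
split=> [/span_cons [c [z [/IH [x sx <-] ->]]]|[_ /span_cons [c [z [sz ->]]] <-]].
  by exists (c *: a + x); rewrite ?linearP //; apply/span_cons; exists c, x.
by apply/span_cons; exists c, (f z); rewrite linearP; split=> //; apply/IH; exists z.
Qed.

Lemma noetherian_module_ext A B C (f : {linear A -> B}) (g : {linear B -> C}) :
  exact f g -> noetherian_module A -> noetherian_module C -> noetherian_module B.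
Proof.
move=> ex nA nC Z Zsub.
have [u uE] := nA _ (submodule_preimage f Zsub).
have [s sE] := nC _ (submodule_image g Zsub).
have [t [tZ tE]] : exists t : seq B, (forall x, x \in t -> Z x) /\ map g t = s.
  have : forall y, y \in s -> exists2 x, Z x & g x = y.
    by move=> y /span_mem; rewrite -sE => -[x Zx xy]; exists x.
  elim: s {sE} => [_|a s IH h]; first by exists [::].
  have [|t [tZ <-]] := IH; first by move=> y ys; apply: h; rewrite inE ys orbT.
  have [x Zx <-] := h a (mem_head _ _).
  exists (x :: t); split=> // z; rewrite inE => /orP[/eqP -> //|]; exact: tZ.
exists (t ++ map f u); apply/seteqP; split=> [z Zz|]; last first.
  apply: span_subset => // x; rewrite mem_cat => /orP[/tZ //|/mapP [y yu ->]].
  by have := span_mem yu; rewrite -uE.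
have gz : span s (g z) by rewrite -sE; exists z.
have [x tx xz] : exists2 x, span t x & g x = g z by apply/span_map; rewrite tE.
have cat (y : B) (r : seq B) : {subset r <= t ++ map f u} -> span r y -> span (t ++ map f u) y.
  by move=> sub; apply: span_subset; [exact: submodule_span|move=> w /sub /span_mem].
have Zx : Z x by apply: span_subset tx.
have /ex [a fa] : g (z - x) = 0 by rewrite linearB xz subrr.
rewrite -[z](subrK x) -fa; apply: submoduleD; first exact: submodule_span.
  apply: (@cat _ (map f u)); first by move=> w wu; rewrite mem_cat wu orbT.
  by apply/span_map; exists a => //; rewrite -uE /preimage /= fa; apply: submoduleB.
by apply: (@cat _ t) => // w wt; rewrite mem_cat wt.
Qed.

Lemma noetherian_module_surj B C (g : {linear B -> C}) :
  surjective_map g -> noetherian_module B -> noetherian_module C.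
Proof.
move=> gsurj nB Z Zsub; have [s sE] := nB _ (submodule_preimage g Zsub).
exists (map g s); apply/seteqP; split=> [z Zz|z /span_map [x sx <-]].
  by have [x xz] := gsurj z; apply/span_map; exists x => //; rewrite -sE /preimage /= xz.
by move: sx; rewrite -sE.
Qed.

Lemma noetherian_module_prod A B :
  noetherian_module A -> noetherian_module B -> noetherian_module (A * B)%type.
Proof.
have [|f fE] := @linear_fun_exists R A (A * B)%type (fun a => (a, 0)).
  by move=> a x y; congr pair; rewrite /= scaler0 addr0.
apply: (@noetherian_module_ext _ _ _ f snd) => -[x y].
by split=> /= [->|[a]]; [exists x; rewrite fE|rewrite fE => -[]].
Qed.

Lemma fg_noetherian M :
  noetherian R -> finitely_generated M -> noetherian_module M.
Proof.
move=> nR [s sT].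
have nR' : noetherian_module R^o by move=> Z [Z0 ZP]; apply: nR.
have [F [g [nF gE]]] : exists (F : lmodType R) (g : {linear F -> M}), noetherian_module F /\
    forall x, span s x -> exists y, g y = x.
  elim: s {sT} => [|a s [F [g [nF gE]]]].
    by exists (R^o : lmodType R), \0; split=> // x /span_nil ->; exists 0.
  have [|h hE] := @linear_fun_exists R (R^o * F)%type M (fun v => (v.1 : R) *: a + g v.2).
    move=> c x y /=; rewrite linearP scalerDl -scalerA scalerDr.
    by rewrite -!addrA; congr (_ + _); rewrite addrCA.
  exists (R^o * F)%type, h; split; first exact: noetherian_module_prod.
  by move=> x /span_cons [c [y [/gE [z <-] ->]]]; exists (c, z); rewrite hE.
by apply: noetherian_module_surj nF => x; apply: gE; rewrite sT.
Qed.

Lemma fg_surj M N (f : {linear M -> N}) :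
  surjective_map f -> finitely_generated M -> finitely_generated N.
Proof.
move=> fsurj [s sT]; exists (map f s); apply/seteqP; split=> // y _.
by have [x xy] := fsurj y; apply/span_map; exists x => //; rewrite sT.
Qed.

Lemma noetherian_fg_sub A M (f : {linear A -> M}) :
  noetherian_module M -> injective f -> finitely_generated A.
Proof.
move=> nM finj; have [s sE] := nM _ (submodule_range f).
have [t tE] : exists t, map f t = s.
  have : forall y, y \in s -> exists x, f x = y.
    by move=> y /span_mem; rewrite -sE => -[x _ xy]; exists x.
  elim: s {sE} => [_|a s IH h]; first by exists [::].
  have [|t <-] := IH; first by move=> y ys; apply: h; rewrite inE ys orbT.
  by have [x <-] := h a (mem_head _ _); exists (x :: t).
exists t; apply/seteqP; split=> // x _.
have : span s (f x) by rewrite -sE; exists x.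
by rewrite -tE => /span_map [y ty /finj <-].
Qed.

(** Zorn's lemma applies because the union of a nonempty chain of submodules is finitely generated,
    hence equal to a member of the chain. *)
Lemma noetherian_max M (F : set (set M)) :
  noetherian_module M -> (forall Z, F Z -> submodule Z) -> F !=set0 ->
  exists2 Z, F Z & forall Z', F Z' -> Z `<=` Z' -> Z' `<=` Z.
Proof.
move=> nM Fsub [Z0 FZ0].
(* The empty set is adjoined to serve as the union of the empty chain. It is not maximal, since [F]
   has a member and that member contains 0. *)
have [|Z [FZ Zmax]] := @Zorn_bigcup M [set Z | Z = set0 \/ F Z]; last first.
  exists Z => [|Z' FZ' ZZ'].
    case: FZ => // Z00; have [Z00' _] := Fsub _ FZ0.
    have ZZ0 : Z `<` Z0.
      by split=> [x|h]; [rewrite Z00|have := h _ Z00'; rewrite Z00].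
    by case: (Zmax _ ZZ0); right.
  by apply: contrapT => nZ; apply: (Zmax Z'); [split|right].
move=> G GF Gtot; set U := \bigcup_(X in G) X.
have [[X GX FX]|nGF] := pselect (exists2 X : set M, G X & F X); last first.
  left; apply/seteqP; split=> // x [X GX Xx]; case: (GF _ GX) => [X0|FX].
    by move: Xx; rewrite X0.
  by case: nGF; exists X.
right; have cofinal (s : seq M) : (forall x, x \in s -> U x) ->
    exists Y : set M, [/\ G Y, F Y & forall x, x \in s -> Y x].
  elim: s => [_|a s IH h]; first by exists X.
  have [|Y [GY FY sY]] := IH; first by move=> y ys; apply: h; rewrite inE ys orbT.
  have [Y' GY' Y'a] := h a (mem_head _ _).
  have FY' : F Y' by case: (GF _ GY') => // Y'0; move: Y'a; rewrite Y'0.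
  have [YY'|Y'Y] := Gtot _ _ GY GY'.
    by exists Y'; split=> // x; rewrite inE => /orP[/eqP ->|/sY /YY'].
  by exists Y; split=> // x; rewrite inE => /orP[/eqP ->|/sY]; first exact: Y'Y.
have Usub : submodule U.
  split=> [|a x y Ux Uy]; first by exists X => //; case: (Fsub _ FX).
  have [|Y [GY FY sY]] := cofinal [:: x; y].
    by move=> z; rewrite !inE => /orP[] /eqP ->.
  exists Y => //; have [_ YP] := Fsub _ FY.
  by apply: YP; apply: sY; rewrite !inE eqxx ?orbT.
have [s sE] := nM _ Usub.
have [|Y [GY FY sY]] := cofinal s; first by move=> x /span_mem; rewrite -sE.
suff -> : U = Y by [].
apply/seteqP; split=> [|x Yx]; last by exists Y.
by rewrite sE; apply: span_subset => //; apply: Fsub.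
Qed.

(** * Quotient modules *)

Section Quotient.
Variables (M : lmodType R) (Z : set M) (Zsub : submodule Z).

(** The proof that Z is a submodule is an argument so that the closure instance can be attached to
    the predicate. *)
Definition quot_pred of submodule Z : {pred M} := fun x => `[< Z x >].

Lemma quot_zmod_closed : zmod_closed (quot_pred Zsub).
Proof.
split=> [|x y /asboolP Zx /asboolP Zy]; apply/asboolP; first by case: Zsub.
exact: submoduleB.
Qed.

HB.instance Definition _ := GRing.isZmodClosed.Build M (quot_pred Zsub) quot_zmod_closed.

Lemma quotient_exists :
  exists Q (q : {linear M -> Q}), surjective_map q /\ forall x, q x = 0 <-> Z x.
Proof.
pose T := Quotient.quot (quot_pred Zsub : zmodClosed M).
pose p : M -> T := \pi_T%qT.
have pD x y : p (x + y) = p x + p y by rewrite /p piE.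
have p_eq x y : p x = p y <-> Z (x - y).
  split=> h; first by apply/asboolP; rewrite -[`[<_>]]/(_ \in quot_pred Zsub) Quotient.idealrBE; apply/eqP.
  by apply/eqP; rewrite -Quotient.idealrBE; apply/asboolP.
pose sc (a : R) (t : T) := p (a *: repr t).
have scE a x : sc a (p x) = p (a *: x).
  apply/p_eq; rewrite -scalerBr; apply: submoduleZ => //; apply/p_eq.
  by rewrite /p reprK.
have psurj t : exists x, p x = t by exists (repr t); rewrite /p reprK.
have scA a b t : sc a (sc b t) = sc (a * b) t.
  by have [x <-] := psurj t; rewrite !scE scalerA.
have sc1 : left_id 1 sc by move=> t; have [x <-] := psurj t; rewrite scE scale1r.
have scDr : right_distributive sc +%R.
  move=> a t u; have [x <-] := psurj t; have [y <-] := psurj u.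
  by rewrite -pD !scE scalerDr pD.
have scDl t : {morph sc^~ t : a b / a + b}.
  by move=> a b /=; have [x <-] := psurj t; rewrite !scE scalerDl pD.
pose Q : lmodType R := HB.pack T (GRing.Zmodule_isLmodule.Build R T scA sc1 scDr scDl).
have [|q qE] := @linear_fun_exists R M Q p.
  by move=> a x y; rewrite pD -scE.
exists Q, q; split=> [t|x]; first by have [x <-] := psurj t; exists x.
rewrite qE -[x in Z x]subr0 -p_eq; have -> // : p 0 = 0.
by rewrite -qE linear0.
Qed.

End Quotient.

Lemma pushout_short_exact W X Y C K (f : {linear W -> X}) (g : {linear W -> Y})
    (h : {linear Y -> C}) (j : {linear X -> K}) (k : {linear Y -> K}) :
  short_exact g h -> pushout f g j k ->
  exists h' : {linear K -> C}, short_exact j h'.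
Proof.
move=> S [comm univ]; have [ginj gex hsurj] := S.
have [|h' [[h'j h'k] _]] := univ C \0 h; first by move=> w; rewrite (short_exact_comp0 S).
have sp_sub : submodule [set z | exists x y, z = j x + k y].
  split=> [|a _ _ [x [y ->]] [x' [y' ->]]]; first by exists 0, 0; rewrite !linear0 addr0.
  by exists (a *: x + x'), (a *: y + y'); rewrite !linearP scalerDr addrACA.
(* Both q and 0 vanish on the images of j and k, so uniqueness in the universal property gives q =
   0, and K is generated by these two images. *)
have [Q [q [qsurj qE]]] := quotient_exists sp_sub.
have gen z : exists x y, z = j x + k y.
  apply/qE; have [|u [_ uniq]] := univ Q \0 \0; first by [].
  rewrite -(uniq q) ?(uniq \0) //; split=> x //=; apply/qE.
    by exists x, 0; rewrite linear0 addr0.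
  by exists 0, x; rewrite linear0 add0r.
exists h'; split=> [|z|c].
(* Injectivity of j is tested on the concrete pushout, the quotient of X x Y by the elements (f w, -
   g w). *)
- have rel_sub : submodule [set v : (X * Y)%type | exists w, v = (f w, - g w)].
    split=> [|a _ _ [w ->] [w' ->]]; first by exists 0; rewrite !linear0.
    by exists (a *: w + w'); rewrite !linearP.
  have [L [p [psurj pE]]] := quotient_exists rel_sub.
  have [|jx jxE] := @linear_fun_exists R X L (fun x => p (x, 0)).
    by move=> a x y; rewrite -linearP; congr (p (_, _)); rewrite /= scaler0 addr0.
  have [|ky kyE] := @linear_fun_exists R Y L (fun y => p (0, y)).
    by move=> a x y; rewrite -linearP; congr (p (_, _)); rewrite /= scaler0 addr0.
  have [|u [[uj uk] _]] := univ L jx ky.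
    move=> w; rewrite jxE kyE; apply/eqP; rewrite -subr_eq0 -linearB; apply/eqP/pE.
    by exists w; congr pair; rewrite /= ?subr0 ?sub0r.
  apply: linear_injP => x jx0; have /pE [w [-> /esym/eqP]] : p (x, 0) = 0.
    by rewrite -jxE -uj jx0 linear0.
  by rewrite oppr_eq0 => /eqP gw; rewrite (ginj w 0) ?linear0.
- split=> [|[x <-] //]; have [x [y ->]] := gen z.
  rewrite linearD h'j h'k add0r => /gex [w <-].
  by exists (x + f w); rewrite linearD comm.
- by have [y <-] := hsurj c; exists (k y); rewrite h'k.
Qed.

End Submodules.

(** * Modules over a local ring *)

Section RowVectors.
Variable R : comNzRingType.
Implicit Types M N U V X : lmodType R.

Lemma rV_hom_exists n U (y : 'I_n -> U) :
  exists h : {linear 'rV[R]_n -> U}, forall v, h v = \sum_i v 0 i *: y i.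
Proof.
have [|h hE] := @linear_fun_exists R 'rV[R]_n U (fun v => \sum_i v 0 i *: y i).
  move=> a v w; rewrite scaler_sumr -big_split /=; apply: eq_bigr => i _.
  by rewrite !mxE scalerDl scalerA.
by exists h.
Qed.

Lemma rV_linear_sum n U (h : {linear 'rV[R]_n -> U}) v :
  h v = \sum_i v 0 i *: h (delta_mx 0 i).
Proof. by rewrite {1}[v]row_sum_delta linear_sum; apply: eq_bigr => i _; rewrite linearZ. Qed.

Lemma projective_rV n : projective 'rV[R]_n.
Proof.
move=> U V g f gsurj; have [s sE] := choice gsurj.
have [h hE] := rV_hom_exists (fun i : 'I_n => s (f (delta_mx 0 i))).
exists h => v; rewrite hE rV_linear_sum linear_sum; apply: eq_bigr => i _.
by rewrite linearZ /= sE.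
Qed.

Lemma fg_rV n : finitely_generated ('rV[R]_n : lmodType R).
Proof.
exists [seq delta_mx 0 i | i <- enum 'I_n]; apply/seteqP; split=> // v _.
rewrite [v]row_sum_delta; have [sp0 spP] := @submodule_span R ('rV[R]_n : lmodType R)
  [seq delta_mx 0 i | i <- enum 'I_n].
elim/big_ind: _ => // [x y ? ?|i _]; first exact: submoduleD.
apply: submoduleZ => //; apply: span_mem; apply/mapP; exists i => //.
by rewrite mem_enum.
Qed.

Lemma fg_rV_surj X : finitely_generated X ->
  exists n (g : {linear 'rV[R]_n -> X}), surjective_map g.
Proof.
move=> [s sT]; have [h hE] := rV_hom_exists (fun i : 'I_(size s) => s`_i).
exists (size s), h => x; have [c ->] : span s x by rewrite sT.
by exists (\row_i c i); rewrite hE; apply: eq_bigr => i _; rewrite mxE.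
Qed.

Lemma linear_inverse U V (g : {linear U -> V}) :
  injective g -> surjective_map g -> retract V U.
Proof.
move=> ginj gsurj.
have [x x0|h hE] := surjective_factor (phi := idfun : {linear U -> U}) gsurj.
  by apply: ginj; rewrite x0 linear0.
exists h, g => v; have [u <-] := gsurj v; by rewrite hE.
Qed.

Lemma fg_regular : finitely_generated (R^o : lmodType R).
Proof.
exists [:: (1 : R^o)]; apply/seteqP; split=> // x _; apply/span_cons.
by exists x, 0; split; [apply/span_nil|rewrite addr0; apply/esym/mulr1].
Qed.

End RowVectors.

(** * Units, minimal presentations and Nakayama's lemma *)

Section LocalRing.
Variables (R : comNzRingType) (m : set R).
Hypotheses (noethR : noetherian R) (locR : local_ring m).
Implicit Types A M N Q U V X : lmodType R.

Lemma max_ideal_sub : submodule (m : set R^o).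
Proof. by case: locR => -[]. Qed.

Lemma max_ideal1 : ~ m 1.
Proof.
case: locR => -[[_ mP] mT _] _ m1; apply: mT; apply/seteqP; split=> // x _.
by rewrite -[x]mulr1 -[_ * _]addr0; apply: mP => //; case: max_ideal_sub.
Qed.

(** Otherwise a generates a proper ideal. By noetherianity it lies in a maximal one, which must be
    m. *)
Lemma local_unit a : ~ m a -> exists b, a * b = 1.
Proof.
move=> ma; apply: contrapT => nu.
pose F : set (set R^o) := [set I : set R^o | [/\ submodule I, I a & ~ I 1]].
have [Z [Zsub Za Z1] Zmax] : exists2 Z, F Z & forall Z', F Z' -> Z `<=` Z' -> Z' `<=` Z.
  apply: noetherian_max; first by apply: fg_noetherian => //; exact: fg_regular.
    by move=> Z [].
  exists (range (fun x : R^o => x * a : R^o)); split.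
  - split=> [|c _ _ [x _ <-] [y _ <-]]; first by exists 0; rewrite ?mul0r.
    by exists (c *: x + y); rewrite // mulrDl -mulrA.
  - by exists 1; rewrite ?mul1r.
  - by move=> [x _ xa]; apply: nu; exists x; rewrite mulrC.
have Zm : maximal_ideal (Z : set R).
  split=> // [ZT|I [I0 IP] ZI IT]; first by apply: Z1; rewrite ZT.
  apply/seteqP; split=> //; apply: Zmax => //; split=> //; first exact: ZI.
  move=> I1; apply: IT; apply/seteqP; split=> // x _.
  by rewrite -[x]mulr1 -[_ * _]addr0; apply: IP.
by apply: ma; rewrite -(locR.2 _ Zm).
Qed.

Lemma minimal_presentation X : finitely_generated X ->
  exists n (g : {linear 'rV[R]_n -> X}), surjective_map g /\
    forall v, g v = 0 -> forall i, m (v 0 i).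
Proof.
move=> fgX; pose P n := `[< exists g : {linear 'rV[R]_n -> X}, surjective_map g >].
have exP : exists n, P n by have [n [g gs]] := fg_rV_surj fgX; exists n; apply/asboolP; exists g.
case: (ex_minnP exP) => n /asboolP [g gsurj] nmin.
exists n, g; split=> // v gv i; apply: contrapT => /local_unit [b vb].
case: n g gsurj nmin v gv i vb => [|n] g gsurj nmin v gv i vb; first by case: i {vb}.
suff : P n by move/nmin; rewrite ltnn.
apply/asboolP; pose e (w : 'rV[R]_n) : 'rV[R]_n.+1 :=
  \row_j (if unlift i j is Some l then w 0 l else 0).
have [|h hE] := @linear_fun_exists R 'rV[R]_n X (g \o e).
  move=> a x y /=; rewrite -linearP; congr (g _); apply/rowP => j; rewrite !mxE.
  by case: unliftP => [l _|_]; rewrite ?mxE // mulr0 addr0.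
exists h => y; have [u <-] := gsurj y; pose u' := u - (u 0 i * b) *: v.
exists (\row_l u' 0 (lift i l)); rewrite hE /=.
have -> : e (\row_l u' 0 (lift i l)) = u'.
  apply/rowP => j; rewrite !mxE; case: unliftP => [l ->|->]; first by rewrite !mxE.
  by rewrite -mulrA [b * _]mulrC vb mulr1 subrr.
by rewrite linearB linearZ /= gv scaler0 subr0.
Qed.

Lemma minimal_rank_gt0 X n (g : {linear 'rV[R]_n -> X}) :
  surjective_map g -> nonzero X -> (0 < n)%N.
Proof.
case: n g => // g gsurj [x]; have [v <-] := gsurj x.
by rewrite [v]rV0_eq0 linear0 eqxx.
Qed.

(** If X = mX, a minimal generator is a combination of elements of X with coefficients in m. The
    resulting relation has a coordinate in 1 + m, while minimality puts it in m. *)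
Lemma nakayama X : finitely_generated X -> (forall x : X, ideal_mul m X x) -> ~ nonzero X.
Proof.
move=> fgX mX X0; have [n [g [gsurj gmin]]] := minimal_presentation fgX.
have := minimal_rank_gt0 gsurj X0; case: n g gsurj gmin => // n g gsurj gmin _.
have [k [a [y [ma yE]]]] := mX (g (delta_mx 0 ord0)).
have [s sE] := choice gsurj.
have /gmin /(_ ord0) : g (delta_mx 0 ord0 - \sum_i a i *: s (y i)) = 0.
  rewrite linearB yE linear_sum -sumrB big1 // => i _.
  by rewrite linearZ /= sE subrr.
have [m0 mP] := max_ideal_sub.
set z := \sum_i _ => h; have mz : m (z 0 ord0).
  rewrite /z summxE; elim/big_ind: _ => // [u v mu mv|i _].
    exact: (@submoduleD R R^o m).
  by rewrite mxE mulrC; apply: (@submoduleZ R R^o m).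
apply: max_ideal1; have := @submoduleD R R^o m _ _ max_ideal_sub h mz.
by rewrite !mxE !eqxx subrK.
Qed.

Lemma exists_notin_max_mul N : finitely_generated N -> nonzero N ->
  exists z : N, ~ ideal_mul m N z.
Proof.
by move=> fgN N0; apply: contrapT => h; apply: (nakayama fgN) N0 => x; apply: contrapT => hx; apply: h; exists x.
Qed.

Lemma max_mul_rV n N (h : {linear 'rV[R]_n -> N}) (v : 'rV[R]_n) :
  (forall i, m (v 0 i)) -> ideal_mul m N (h v).
Proof.
by move=> mv; exists n, (fun i => v 0 i), (fun i => h (delta_mx 0 i)); rewrite -rV_linear_sum.
Qed.

Lemma max_mul0 N : ideal_mul m N 0.
Proof. by exists 0, (fun=> 0), (fun=> 0); split=> [[]//|]; rewrite big_ord0. Qed.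

(** The first coordinate times u kills every relation of a minimal presentation, as their
    coordinates lie in m. *)
Lemma hom_to_socle X N (u : N) : finitely_generated X -> nonzero X ->
  u != 0 -> (forall a, m a -> a *: u = 0) ->
  exists (phi : {linear X -> N}) x, phi x != 0.
Proof.
move=> fgX X0 u0 mu; have [n [g [gsurj gmin]]] := minimal_presentation fgX.
have := minimal_rank_gt0 gsurj X0; case: n g gsurj gmin => // n g gsurj gmin _.
have [|h hE] := @linear_fun_exists R 'rV[R]_n.+1 N (fun v => v 0 ord0 *: u).
  by move=> a v w; rewrite !mxE scalerDl scalerA.
have [v gv|phi phiE] := surjective_factor (phi := h) gsurj.
  by rewrite hE mu //; apply: gmin.
by exists phi, (g (delta_mx 0 ord0)); rewrite phiE hE mxE !eqxx scale1r.
Qed.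

(* [b] is the projective dimension of [X] when [X] is nonzero. *)
Definition has_ext_degree X (b : nat) :=
  (forall N i, (b < i)%N -> ext_vanishes N i X) /\
  (nonzero X -> forall N, finitely_generated N -> nonzero N ->
     ~ ext_vanishes N b X /\
     (b = 0%N -> exists (phi : {linear X -> N}) x, ~ ideal_mul m N (phi x))).

Lemma free_ext_degree X n (g : {linear 'rV[R]_n -> X}) :
  injective g -> surjective_map g -> has_ext_degree X 0.
Proof.
move=> ginj gsurj; have ret := linear_inverse ginj gsurj.
split=> [N [|i] // _|X0 N fgN N0].
  by apply/ext_projective/(projective_retract _ ret); apply: projective_rV.
have := minimal_rank_gt0 gsurj X0; case: n g ginj gsurj {ret} => // n g ginj gsurj _.
have [z mz] := exists_notin_max_mul fgN N0.
have [h hE] := rV_hom_exists (fun i : 'I_n.+1 => if i == ord0 then z else 0).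
have [v gv|phi phiE] := surjective_factor (phi := h) gsurj.
  by rewrite (ginj v 0) ?linear0.
have zE : phi (g (delta_mx 0 ord0)) = z.
  rewrite phiE hE (bigD1 ord0) //= big1 => [|i /negPf i0]; last by rewrite i0 scaler0.
  by rewrite mxE !eqxx scale1r addr0.
split=> [/(_ phi (g (delta_mx 0 ord0)))|_].
  by rewrite zE => z0; apply: mz; rewrite z0; apply: max_mul0.
by exists phi, (g (delta_mx 0 ord0)); rewrite zE.
Qed.

(** The degree of X is one more than that of the kernel of a minimal presentation, and it is 0 when
    this kernel vanishes. *)
Lemma finite_pd_ext_degree n X : finitely_generated X ->
  (forall N, ext_vanishes N n.+1 X) -> exists b, has_ext_degree X b.
Proof.
elim: n X => [|n IH] X fgX X0; have [k [g [gsurj gmin]]] := minimal_presentation fgX;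
  have S := short_exact_kernel gsurj; have [iinj _ _] := S.
  (* The identity of the kernel extends to a retraction r of the free module. By minimality every
     element of the kernel has coordinates in m, so the kernel equals m times itself and vanishes by
     Nakayama. *)
  have [r rE] := X0 (kernel g) _ _ _ _ S idfun.
  exists 0%N; apply: (free_ext_degree (g := g)) => //; apply: linear_injP => v gv.
  have : ~ nonzero (kernel g).
    apply: nakayama => [|x].
      by apply: fg_surj (fg_rV R k) => // x; exists (kernel_incl g x); apply: rE.
    rewrite -[x]rE; apply: max_mul_rV; apply: gmin; exact: (short_exact_comp0 S).
  have [_ ex _] := S; have /ex [x <-] := gv => nz.
  have [->|x0] := eqVneq x 0; first by rewrite linear0.
  by case: nz; exists x.
have [nzA|zA] := pselect (nonzero (kernel g)); last first.
  exists 0%N; apply: (free_ext_degree (g := g)) => //; apply: linear_injP => v gv.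
  have [_ ex _] := S; have /ex [x <-] := gv.
  have [->|x0] := eqVneq x 0; first by rewrite linear0.
  by case: zA; exists x.
have prF := @projective_rV R k.
have fgA : finitely_generated (kernel g).
  by apply: noetherian_fg_sub iinj; apply: fg_noetherian => //; apply: fg_rV.
have [|b [bA bN]] := IH (kernel g) fgA; first by move=> N; apply: X0 S prF.
exists b.+1; split=> [N [|[|i]] // bi|_ N fgN N0]; first exact/(ext_shift N i S prF)/bA.
have [nb b0] := bN nzA _ fgN N0; split=> // E.
case: b {bA bN} E nb b0 => [|b] E nb b0; last by apply: nb; apply: E S prF.
(* Passing from degree 0 to 1 needs more than Hom being nonzero: a map on the kernel that extends to
   the free module has its image in mN by minimality, whereas [phi] leaves mN. *)
have [phi [x mx]] := b0 erefl; have [psi psiE] := E _ _ _ _ S phi.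
apply: mx; rewrite -psiE; apply: max_mul_rV; apply: gmin; exact: (short_exact_comp0 S).
Qed.

End LocalRing.

(** * Regular elements and the socle *)

Section Socle.
Variables (R : comNzRingType) (m : set R).
Hypotheses (noethR : noetherian R) (locR : local_ring m).
Implicit Types M N Q X : lmodType R.

Definition regular_on N (U : set N) (x : R) := forall u, U u -> x *: u = 0 -> u = 0.

Lemma regular_onX N (U : set N) x k :
  submodule U -> regular_on U x -> regular_on U (x ^+ k).
Proof.
move=> Usub xreg; elim: k => [|k IH] u Uu; first by rewrite scale1r.
by rewrite exprS -scalerA => /xreg h; apply: IH => //; apply: h; apply: submoduleZ.
Qed.

(* The kernels of the operators x + y^(k+1) are independent, like eigenspaces,
   so by the ascending chain condition one of them vanishes. *)
Lemma regular_on_translate N (U : set N) x y :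
  noetherian_module N -> submodule U -> m y -> regular_on U x ->
  exists k, regular_on U (x + y ^+ k.+1).
Proof.
move=> nN Usub my xreg.
pose p k := \prod_(i < k) (x + y ^+ i.+1).
pose V k := [set u | U u /\ p k *: u = 0].
have Vsub k : submodule (V k).
  split=> [|a u w [Uu pu] [Uw pw]]; first by split; [case: Usub|rewrite scaler0].
  split; first by case: Usub => _; apply.
  by rewrite scalerDr pw addr0 scalerA mulrC -scalerA pu scaler0.
have [_ [r _ <-] Vmax] : exists2 Z, range V Z &
    forall Z', range V Z' -> Z `<=` Z' -> Z' `<=` Z.
  by apply: noetherian_max => // [Z [k _ <-] //|]; exists (V 0%N); exists 0%N.
(* The submodules V k increase and V r is the largest of them. An element killed by x + y^(r+1) lies
   in V (r+1), hence in V r. *)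
exists r => u Uu ru.
have [_ pu] : V r u.
  apply: (Vmax (V r.+1)); first by exists r.+1.
    move=> w [Uw pw]; split=> //.
    by rewrite /p big_ord_recr /= mulrC -scalerA pw scaler0.
  by split=> //; rewrite /p big_ord_recr /= -scalerA ru scaler0.
pose W := [set w | U w /\ (x + y ^+ r.+1) *: w = 0].
have Wsub : submodule W.
  split=> [|a v w [Uv rv] [Uw rw]]; first by split; [case: Usub|rewrite scaler0].
  split; first by case: Usub => _; apply.
  by rewrite scalerDr rw addr0 scalerA mulrC -scalerA rv scaler0.
have yreg : regular_on W y.
  move=> w [Uw rw] yw; apply: (xreg) => //; move: rw.
  by rewrite scalerDl exprSr -scalerA yw scaler0 addr0.
(* On W, x acts as - y^(r+1), so x + y^(k+1) acts as y^(k+1) (1 - y^(r-k)): a power of an element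
   regular on W times a unit. The factors of p r can thus be cancelled one by one. *)
have red k w : (k <= r)%N -> W w -> p k *: w = 0 -> w = 0.
  elim: k w => [|k IH] w kr Ww; first by rewrite /p big_ord0 scale1r.
  rewrite /p big_ord_recr /= -/(p k) => pw; apply: IH => //; first exact: ltnW.
  have Wpw : W (p k *: w) by apply: submoduleZ.
  have [b bE] : exists b, (1 - y ^+ (r - k)) * b = 1.
    apply: (local_unit noethR locR) => m1; apply: (max_ideal1 locR).
    rewrite -[1](subrK (y ^+ (r - k))); apply: (@submoduleD R R^o m) => //.
      exact: max_ideal_sub locR.
    rewrite -(prednK (_ : 0 < r - k)%N) ?subn_gt0 // exprSr.
    by apply: (@submoduleZ R R^o m) => //; apply: max_ideal_sub.
  have e : (y ^+ k.+1 * (1 - y ^+ (r - k))) *: (p k *: w) = 0.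
    have [_ /= rw] := Wpw.
    rewrite mulrBr mulr1 -exprD addSn subnKC; last exact: ltnW.
    have -> : y ^+ k.+1 - y ^+ r.+1 = (x + y ^+ k.+1) - (x + y ^+ r.+1).
      by rewrite opprD addrACA subrr add0r.
    by rewrite scalerBl rw subr0 scalerA mulrC.
  apply: (regular_onX (k := k.+1) Wsub yreg) => //.
  have <- : b * (y ^+ k.+1 * (1 - y ^+ (r - k))) = y ^+ k.+1.
    by rewrite mulrCA [b * _]mulrC bE mulr1.
  by rewrite -scalerA e scaler0.
exact: (red r u).
Qed.

(** This replaces prime avoidance. Take U maximal among the submodules on which some x in m is
    regular. If x kills a nonzero element of N and the socle is zero, U can be enlarged by a cyclic
    module Rn with xn = 0, after changing x to x + y^(k+1). *)
Lemma socle_or_regular N : finitely_generated N ->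
  (exists2 x, m x & regular_on [set: N] x) \/
  (exists2 u : N, u != 0 & forall a, m a -> a *: u = 0).
Proof.
move=> fgN; have nN := fg_noetherian noethR fgN.
have nR := fg_noetherian noethR (fg_regular R).
have [soc|nsoc] := pselect (exists2 u : N, u != 0 & forall a, m a -> a *: u = 0).
  by right.
left; have msub := max_ideal_sub locR.
have soc0 (u : N) : u != 0 -> exists2 y, m y & y *: u != 0.
  move=> u0; apply: contrapT => h; apply: nsoc; exists u => // a ma.
  by apply/eqP; apply: contrapT => au; apply: h; exists a => //; apply/negP.
pose F := [set U : set N | submodule U /\ exists2 x, m x & regular_on U x].
have [U [Usub [x mx xU]] Umax] : exists2 U, F U & forall U', F U' -> U `<=` U' -> U' `<=` U.
  apply: noetherian_max => // [U []//|].
  exists [set 0]; split; first by split=> // a _ _ -> ->; rewrite scaler0 addr0.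
  by exists 0; [case: msub|move=> u ->].
exists x => // u _ xu; apply/eqP; apply: contrapT => /negP u0.
pose ann (n : N) : set R^o := [set a | a *: n = 0].
have annsub n : submodule (ann n).
  split=> [|a b c /= bn cn]; first exact: scale0r.
  suff : (a : R) *: ((b : R) *: n) + (c : R) *: n = 0 by rewrite scalerA -scalerDl.
  by rewrite bn cn scaler0 addr0.
have [_ [n [n0 xn] <-] nmax] : exists2 A, (ann @` [set n | n != 0 /\ x *: n = 0]) A &
    forall A', (ann @` [set n | n != 0 /\ x *: n = 0]) A' -> A `<=` A' -> A' `<=` A.
  by apply: noetherian_max => // [A [n _ <-] //|]; exists (ann u), u.
have [y my yn] := soc0 n n0.
pose L := range (fun a : R => a *: n).
have Lsub : submodule L.
  split=> [|a _ _ [b _ <-] [c _ <-]]; first by exists 0; rewrite ?scale0r.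
  by exists (a * b + c); rewrite // scalerDl scalerA.
(* If y killed a nonzero multiple an, then ann(an), which contains ann(n), would equal it by
   maximality, and yn would be 0. *)
have yL : regular_on L y.
  move=> _ [a _ <-] yan; apply/eqP; apply: contrapT => /negP an0.
  have /nmax : (ann @` [set n | n != 0 /\ x *: n = 0]) (ann (a *: n)).
    by exists (a *: n) => //; split=> //; rewrite scalerA mulrC -scalerA xn scaler0.
  move/(_ _ y yan) => yn0; case/negP: yn; apply/eqP; apply: yn0 => b bn.
  by rewrite /ann /= scalerA mulrC -scalerA bn scaler0.
have [k xyU] := regular_on_translate nN Usub my xU.
pose z := x + y ^+ k.+1; pose U' := [set w | exists v l, [/\ U v, L l & w = v + l]].
have U'sub : submodule U'.
  split=> [|a _ _ [v [l [Uv Ll ->]]] [v' [l' [Uv' Ll' ->]]]].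
    by exists 0, 0; split; [case: Usub|case: Lsub|rewrite addr0].
  exists (a *: v + v'), (a *: l + l'); split; first by case: Usub => _; apply.
    by case: Lsub => _; apply.
  by rewrite scalerDr addrACA.
(* If z(v + l) = 0, then zv = - zl = - y^(k+1) l is killed by x, as x kills L. So zv = 0 and v = 0
   by regularity on U, and then l = 0 by regularity of y on L. *)
have zU' : regular_on U' z.
  move=> _ [v [l [Uv Ll ->]]] zvl.
  have xl : x *: l = 0.
    by case: Ll => a _ <-; rewrite scalerA mulrC -scalerA xn scaler0.
  have zl : z *: l = y ^+ k.+1 *: l by rewrite scalerDl xl add0r.
  have zv0 : z *: v = 0.
    apply: xU; first exact: submoduleZ.
    have /eqP : z *: v + z *: l = 0 by rewrite -scalerDr.
    rewrite addr_eq0 => /eqP ->.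
    by rewrite scalerN scalerA mulrC -scalerA xl scaler0 oppr0.
  have v0 := xyU v Uv zv0; move: zvl; rewrite v0 !add0r zl.
  exact: (regular_onX Lsub yL Ll).
have /Umax UU' : F U'.
  split=> //; exists z => //; apply: (@submoduleD R R^o m) => //.
  by rewrite exprSr; apply: (@submoduleZ R R^o m).
case/negP: n0; apply/eqP; apply: (xU n) => //; apply: UU'.
  by move=> v Uv; exists v, 0; split; [|case: Lsub|rewrite addr0].
exists 0, n; split; [by case: Usub| |by rewrite add0r].
by exists 1; rewrite ?scale1r.
Qed.

Lemma ext_nonvanishing X N :
  finitely_generated X -> nonzero X -> finitely_generated N -> nonzero N ->
  ~ forall i, ext_vanishes N i X.
Proof.
move=> fgX X0 fgN [n0 n0n] XN; have nN := fg_noetherian noethR fgN.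
(* A maximal Z for which N/Z is nonzero and all Ext^i(X, N/Z) vanish makes the repeated division by
   regular elements stop. *)
pose F := [set Z : set N | [/\ submodule Z, exists n, ~ Z n &
  exists Q (q : {linear N -> Q}), [/\ surjective_map q, forall x, q x = 0 <-> Z x &
    forall i, ext_vanishes Q i X]]].
have [Z [Zsub [n Zn] [Q [q [qsurj qE XQ]]]] Zmax] :
    exists2 Z, F Z & forall Z', F Z' -> Z `<=` Z' -> Z' `<=` Z.
  apply: noetherian_max => // [Z []//|]; exists [set 0]; split.
  - by split=> // a _ _ -> ->; rewrite scaler0 addr0.
  - by exists n0 => /= n00; rewrite n00 eqxx in n0n.
  - by exists N, idfun; split=> // x; exists x.
have fgQ := fg_surj qsurj fgN.
have Q0 : nonzero Q by exists (q n); apply/eqP => /qE.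
have [[x mx xreg]|[u u0 mu]] := socle_or_regular fgQ; last first.
  have [phi [y]] := hom_to_socle noethR locR fgX X0 u0 mu.
  by rewrite (XQ 0%N phi y) eqxx.
pose xQ : {linear Q -> Q} := x \*: idfun.
have [Q' [p [psurj pE]]] := quotient_exists (submodule_range xQ).
have S : short_exact xQ p.
  split=> // [|y]; first by apply: linear_injP => v xv; apply: xreg.
  by rewrite pE; split=> [[v _ <-]|[v <-]]; exists v.
have [z nz] := exists_notin_max_mul noethR locR fgQ Q0.
have /Zmax ZZ' : F [set v | p (q v) = 0].
  split.
  - split=> [|a v w /= v0 w0] /=; first by rewrite !linear0.
    by rewrite !linearP v0 w0 scaler0 addr0.
  - have [v vz] := qsurj z; exists v => /=; rewrite vz => /pE [w _ wz]; apply: nz.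
    by exists 1%N, (fun=> x), (fun=> w); rewrite big_ord1 -wz.
  - exists Q', (p \o q : {linear N -> Q'}); split=> // [c|i].
      by have [b <-] := psurj c; have [a <-] := qsurj b; exists a.
    exact: ext_second_right S (XQ i) (XQ i.+1).
(* Q/xQ is again admissible, so maximality of Z forces xQ = 0, which is absurd for x regular on Q
   and Q nonzero. *)
have [y] := Q0; rewrite (xreg y) ?eqxx //.
have [v vE] := qsurj (x *: y); rewrite -vE; apply/qE; apply: ZZ'.
  by move=> w /qE /= ->; rewrite linear0.
by rewrite /= vE; apply/pE; exists y.
Qed.

End Socle.

(** * Modules of reducible complexity *)

Section ReducibleComplexity.
Variables (R : comNzRingType) (m : set R).
Hypotheses (noethR : noetherian R) (locR : local_ring m).
Implicit Types K M N X : lmodType R.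

(** Regular sequences are required to satisfy IX <> X, which excludes the zero module. This provides
    a nonzero K in a reduction. *)
Lemma depth_nonzero X d : is_depth m X d -> nonzero X.
Proof.
move=> [[s [_ _ sT] _] _]; apply: contrapT => X0; apply: sT; apply/seteqP; split=> // x _.
have [->|x0] := eqVneq x 0; first exact: max_mul0.
by case: X0; exists x.
Qed.

Lemma reduction_short_exact X K (P : projective_resolution X) t
    (f : {linear syzygy P t.+1 -> X}) (j : {linear X -> K}) (k : {linear P t -> K}) :
  pushout f (syzygy_incl P t) j k -> exists h : {linear K -> syzygy P t}, short_exact j h.
Proof. by have [g S] := syzygy_presentation P t; apply: pushout_short_exact S. Qed.

Lemma rc_ext_degree X : reducible_complexity m X ->
  exists b, forall N, finitely_generated N ->
    (exists n, forall i, (n <= i)%N -> ext_vanishes N i X) ->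
    (forall i, (b < i)%N -> ext_vanishes N i X) /\
    (nonzero X -> nonzero N -> ~ ext_vanishes N b X).
Proof.
elim=> {X} [X n fgX pdX|X c P beta t f K j k c' d fgX _ _ _ push _ _ depK _ _ [b bK]].
  have [N|b [bX bN]] := finite_pd_ext_degree noethR locR fgX (n := n).
    exact: pd_le_ext.
  exists b => N fgN _; split=> [i|X0 N0]; first exact: bX.
  by have [] := bN X0 N fgN N0.
have [h S] := reduction_short_exact push.
exists b => N fgN [n XN].
have Ksyz i : ext_vanishes N (i + t).+1 X -> ext_vanishes N i.+1 X -> ext_vanishes N i.+1 K.
  by move=> h1 h2; apply: ext_middle S h2 _; apply/ext_syzygy.
have [|Kb Kn] := bK N fgN.
  exists n.+1 => -[//|i] ni; apply: Ksyz; apply: XN; last exact: ltnW.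
  by apply: leq_trans (ltnW ni) _; rewrite ltnS leq_addr.
(* Above b, Ext^i(X, N) lies between Ext^i(K, N) = 0 and Ext^(i+1) of the syzygy, which is
   Ext^(i+t+1)(X, N). Vanishing thus descends by t + 1 degrees at a time, starting from the range
   beyond n. *)
have step i : (b < i)%N -> ext_vanishes N (i + t).+1 X -> ext_vanishes N i X.
  case: i => // i bi XN'; apply: ext_left S (Kb _ bi) _.
  by apply/ext_syzygy.
have Xb i : (b < i)%N -> ext_vanishes N i X.
  have [s] : exists s, (n <= i + s)%N by exists n; rewrite leq_addl.
  elim: s i => [|s IH] i ni bi; first by apply: XN; rewrite addn0 in ni.
  apply: step => //; apply: IH; last by rewrite ltnS (leq_trans (ltnW bi)) ?leq_addr.
  by apply: leq_trans ni _; rewrite addnS addSn ltnS -addnA leq_add2l leq_addl.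
(* If b = 0, all Ext^i(X, N) would vanish. If b > 0, the vanishing of Ext^b(X, N) would pass to K:
   the syzygy contributes Ext^(b+t)(X, N), which is this same group for t = 0 and has degree above b
   otherwise. *)
split=> // X0 N0; case: b {bK step} Kb Kn Xb => [|b] Kb Kn Xb Xb0.
  by apply: (ext_nonvanishing noethR locR fgX X0 fgN N0) => -[|i]; last exact: Xb.
apply: Kn => //; first exact: depth_nonzero depK.
apply: Ksyz => //; case: t {f j k h push S} => [|t]; first by rewrite addn0.
by apply: Xb; rewrite ltnS addnS ltnS leq_addr.
Qed.

(** * Projective dimension from self-extensions *)

Lemma fg_resolution_exists X : finitely_generated X ->
  exists P : projective_resolution X, forall n, finitely_generated (P n).
Proof.
move=> fgX; apply: (resolution_exists (S := @finitely_generated R)) fgX => C fgC.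
have [n [g gsurj]] := fg_rV_surj fgC.
exists (kernel g : lmodType R), 'rV[R]_n, (kernel_incl g), g.
split; [exact: short_exact_kernel|exact: projective_rV| |exact: fg_rV].
by apply: noetherian_fg_sub (val_inj : injective (kernel_incl g)); apply: fg_noetherian => //; apply: fg_rV.
Qed.

Lemma fg_projective_retract X : finitely_generated X -> projective X ->
  exists n, retract X 'rV[R]_n.
Proof.
move=> fgX prX; have [n [g gsurj]] := fg_rV_surj fgX.
by have [h hE] := prX _ _ g (idfun : {linear X -> X}) gsurj; exists n, h, g.
Qed.

Lemma ext_second_rV i M n : ext_vanishes R^o i M -> ext_vanishes 'rV[R]_n i M.
Proof.
move=> M0; elim: n => [|n IH].
  pose Z : {linear R^o -> 'rV[R]_0} := \0.
  apply: (ext_second_retract _ M0); exists \0, Z => x; exact/esym/rV0_eq0.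
have [h hE] : exists h : {linear 'rV[R]_n.+1 -> (R^o * 'rV[R]_n)%type},
    forall v, h v = (v 0 ord0, \row_j v 0 (lift ord0 j)).
  apply: linear_fun_exists => a v w; congr pair; first by rewrite !mxE.
  by apply/rowP => j; rewrite !mxE.
have [|h' h'E] := @linear_fun_exists R (R^o * 'rV[R]_n)%type 'rV[R]_n.+1
    (fun v => \row_j (if unlift ord0 j is Some l then v.2 0 l else v.1)).
  by move=> a v w; apply/rowP => j; rewrite !mxE; case: unlift => [l|]; rewrite ?mxE.
apply: (ext_second_retract (N := (R^o * 'rV[R]_n)%type)); last exact: ext_second_prod.
exists h, h' => v; rewrite h'E hE; apply/rowP => j; rewrite mxE.
by case: unliftP => [l ->|->] /=; rewrite ?mxE.
Qed.

Lemma ext_second_fg_projective i M X :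
  finitely_generated X -> projective X -> ext_vanishes R^o i M -> ext_vanishes X i M.
Proof.
move=> fgX prX M0; have [n ret] := fg_projective_retract fgX prX.
exact: ext_second_retract ret (ext_second_rV n M0).
Qed.

(* The groups Ext^i(M, syzygy of M) vanish for large i, hence for i > b; in
   degree b + 1 this splits off the b-th syzygy from a projective module. *)
Lemma pd_le_of_self_ext M b : finitely_generated M ->
  (forall N, finitely_generated N ->
    (exists n, forall i, (n <= i)%N -> ext_vanishes N i M) ->
    forall i, (b < i)%N -> ext_vanishes N i M) ->
  (exists n, forall i, (n <= i)%N -> ext_vanishes M i M) ->
  (exists n, forall i, (n <= i)%N -> ext_vanishes R^o i M) ->
  pd_le M b.
Proof.
move=> fgM bM [n MM] [n' MR]; have [P fgP] := fg_resolution_exists fgM.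
have fgsyz k : finitely_generated (syzygy P k).
  case: k => // k; apply: noetherian_fg_sub (val_inj : injective (syzygy_incl P k)).
  exact: fg_noetherian.
have syz0 k : exists n, forall i, (n <= i)%N -> ext_vanishes (syzygy P k) i M.
  elim: k => [|k [l kl]]; first by exists n.
  have [g S] := syzygy_presentation P k.
  exists (maxn l n').+2 => -[|[|i]] //; rewrite !ltnS geq_max => /andP[li ni].
  apply: ext_second_left S (kl _ (leqW li)) _.
  by apply: ext_second_fg_projective => //; [apply: res_projective|apply: MR; do 2!apply: leqW].
have prsyz : projective (syzygy P b).
  have [g S] := syzygy_presentation P b; have [_ ex gsurj] := S.
  have E : ext1_vanishes (syzygy P b.+1) (syzygy P b).
    apply/(ext_syzygy (syzygy P b.+1) P 0 b); rewrite add0n.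
    exact: bM (fgsyz _) (syz0 _) _ _.
  (* The identity of the b-th syzygy lifts to P_b, since Ext^1 from this syzygy to the next one is
     Ext^(b+1) from M. *)
  have [s sE] := ext1_hom_lift S E (idfun : {linear syzygy P b -> syzygy P b}).
  by apply: (projective_retract (@res_projective _ _ P b)); exists s, g.
have pdsyz k : (k <= b)%N -> pd_le (syzygy P (b - k)) k.
  elim: k => [_|k IH kb]; first by rewrite subn0; apply: pd_le_projective.
  have [g S] := syzygy_presentation P (b - k.+1).
  apply: pd_le_presentation S (@res_projective _ _ P _) _.
  by rewrite subnSK //; apply: IH; apply: ltnW.
by have := pdsyz b (leqnn b); rewrite subnn.
Qed.

End ReducibleComplexity.

(** * Duality and total reflexivity *)

Section Duality.
Variable R : comNzRingType.
Implicit Types A B C K M P X : lmodType R.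

Definition dual_fun A B (f : {linear A -> B}) (phi : dual B) : dual A :=
  ((phi : {linear B -> R^o}) \o f : {linear A -> R^o}).

Lemma dual_fun_linear A B (f : {linear A -> B}) : linear (dual_fun f).
Proof. by move=> a phi psi; apply: homP. Qed.

HB.instance Definition _ A B (f : {linear A -> B}) :=
  GRing.isLinear.Build R (dual B) (dual A) *:%R (dual_fun f) (dual_fun_linear f).

Definition dual_map A B (f : {linear A -> B}) : {linear dual B -> dual A} := dual_fun f.

Lemma dual_mapE A B (f : {linear A -> B}) phi x : eval_at x (dual_map f phi) = eval_at (f x) phi.
Proof. by []. Qed.

Lemma dualP M (phi psi : dual M) : (forall x, eval_at x phi = eval_at x psi) -> phi = psi.
Proof. exact: homP. Qed.

Lemma bidualityE M (x : M) phi : eval_at phi (biduality x) = eval_at x phi.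
Proof. by []. Qed.

Lemma biduality_natural A B (f : {linear A -> B}) x :
  dual_map (dual_map f) (biduality x) = biduality (f x).
Proof. exact: dualP. Qed.

Lemma dual_short_exact A B C (f : {linear A -> B}) (g : {linear B -> C}) :
  short_exact f g -> ext1_vanishes R^o C -> short_exact (dual_map g) (dual_map f).
Proof.
move=> S C0; have [finj fex gsurj] := S; split.
- move=> phi psi e; apply: dualP => c; have [b <-] := gsurj c.
  exact: (congr1 (eval_at b) e).
- move=> phi; split=> [fphi|[psi <-]]; last first.
    by apply: dualP => a; rewrite !dual_mapE (short_exact_comp0 S) /eval_at linear0.
  have [b /fex [a <-]|psi psiE] := surjective_factor (phi := (phi : {linear B -> R^o})) gsurj.
    exact: (congr1 (eval_at a) fphi).
  by exists psi; apply: dualP.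
- move=> phi; have [psi psiE] := C0 _ _ _ _ S phi.
  by exists psi; apply: dualP.
Qed.

Lemma biduality_linear M : linear (@biduality R M).
Proof. by move=> a x y; apply: dualP => phi; apply: (linearP (phi : {linear M -> R^o})). Qed.

HB.instance Definition _ M :=
  GRing.isLinear.Build R M (dual (dual M)) *:%R (@biduality R M) (@biduality_linear M).

Lemma injective_surjective_bijective (U V : Type) (f : U -> V) :
  injective f -> surjective_map f -> bijective f.
Proof.
move=> finj fsurj; have [h hE] := choice fsurj.
by exists h => // x; apply: finj; rewrite hE.
Qed.

Lemma bijective_surjective (U V : Type) (f : U -> V) : bijective f -> surjective_map f.
Proof. by move=> [h _ hK] y; exists (h y). Qed.

(** The image in B** of an element of A** comes from some b in B. As C embeds in its bidual, b maps
    to 0 in C and comes from A; surjectivity of the dual of f makes A** -> B** injective, so this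
    preimage is the right one. *)
Lemma reflexive_left A B C (f : {linear A -> B}) (g : {linear B -> C}) :
  short_exact f g -> ext1_vanishes R^o C -> reflexive_module B ->
  injective (@biduality R C) -> reflexive_module A.
Proof.
move=> S C0 Brefl Cinj; have [finj fex gsurj] := S.
have [_ _ dfsurj] := dual_short_exact S C0.
apply: injective_surjective_bijective => [a a' e|y].
  by apply/finj/(bij_inj Brefl); rewrite -!biduality_natural e.
have [b bE] := bijective_surjective Brefl (dual_map (dual_map f) y).
have /fex [a aE] : g b = 0.
  apply: Cinj; rewrite -biduality_natural bE linear0; apply: dualP => phi.
  rewrite !dual_mapE (_ : dual_map f _ = 0); first exact: (linear0 (y : {linear _ -> _})).
  apply: dualP => a; rewrite !dual_mapE (short_exact_comp0 S).
  exact: (linear0 (phi : {linear _ -> _})).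
exists a; apply: dualP => phi; have [psi <-] := dfsurj phi.
by rewrite -[RHS]dual_mapE -bE -aE -biduality_natural.
Qed.

(** In the dual sequence, a functional on the dual of C is evaluation at some c; evaluation at a
    lift of c to B extends it. *)
Lemma ext1_dual_left A B C (f : {linear A -> B}) (g : {linear B -> C}) :
  short_exact f g -> ext1_vanishes R^o C -> ext1_vanishes R^o (dual B) ->
  surjective_map (@biduality R C) -> ext1_vanishes R^o (dual A).
Proof.
move=> S C0 B0 Csurj; have [_ _ gsurj] := S.
apply: (ext1_of_short_exact (dual_short_exact S C0) B0) => phi.
have [c cE] := Csurj phi; have [b bE] := gsurj c.
exists (biduality b) => psi; rewrite -cE -bE; exact: dual_mapE.
Qed.

Lemma dual_retract A B : retract A B -> retract (dual A) (dual B).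
Proof.
move=> [i [r ri]]; exists (dual_map r), (dual_map i) => phi; apply: dualP => x.
by rewrite !dual_mapE ri.
Qed.

Lemma reflexive_retract A B : retract A B -> reflexive_module B -> reflexive_module A.
Proof.
move=> [i [r ri]] Brefl; apply: injective_surjective_bijective => [a a' e|y].
  by rewrite -(ri a) -(ri a'); congr (r _); apply/(bij_inj Brefl); rewrite -!biduality_natural e.
have [b bE] := bijective_surjective Brefl (dual_map (dual_map i) y).
exists (r b); rewrite -biduality_natural bE; apply: dualP => phi; rewrite !dual_mapE.
by congr (eval_at _ y); apply: dualP => x; rewrite !dual_mapE ri.
Qed.

Lemma rV_coordinate n (i : 'I_n) : exists phi : dual 'rV[R]_n, forall v, eval_at v phi = v 0 i.
Proof.
have [|h hE] := @linear_fun_exists R 'rV[R]_n R^o (fun v => v 0 i).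
  by move=> a v w; rewrite !mxE.
by exists h.
Qed.

Lemma projective_dual_rV n : projective (dual 'rV[R]_n).
Proof.
have [|i iE] := @linear_fun_exists R (dual 'rV[R]_n) 'rV[R]_n
    (fun phi => \row_j eval_at (delta_mx 0 j) phi).
  by move=> a phi psi; apply/rowP => j; rewrite !mxE.
have [e eE] := choice (@rV_coordinate n).
have [r rE] := rV_hom_exists e.
apply: (projective_retract (@projective_rV R n)); exists i, r => phi; apply: dualP => v.
rewrite rE -[eval_at v _]/(eval_at v (_ : dual _)) linear_sum [RHS](rV_linear_sum phi).
apply: eq_bigr => j _; rewrite linearZ /= eE iE mxE; exact: mulrC.
Qed.

Lemma reflexive_rV n : reflexive_module ('rV[R]_n : lmodType R).
Proof.
have [e eE] := choice (@rV_coordinate n).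
apply: injective_surjective_bijective => [v w vw|y].
  by apply/rowP => i; rewrite -!eE; apply: (congr1 (eval_at (e i)) vw).
exists (\row_i eval_at (e i) y); apply: dualP => phi; rewrite bidualityE.
have -> : phi = \sum_i eval_at (delta_mx 0 i) phi *: e i.
  apply: dualP => v; rewrite linear_sum [LHS](rV_linear_sum phi).
  by apply: eq_bigr => j _; rewrite linearZ /= eE; apply: mulrC.
rewrite [RHS](linear_sum (y : {linear _ -> _})) linear_sum.
apply: eq_bigr => i _; rewrite [RHS](linearZ_LR (y : {linear _ -> _})) linearZ /=.
by rewrite eE mxE.
Qed.

Lemma reflexive_rV_retract n P : retract P 'rV[R]_n ->
  reflexive_module P /\ projective (dual P).
Proof.
move=> ret; split; first exact: reflexive_retract ret (reflexive_rV n).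
exact: (projective_retract (@projective_dual_rV n) (dual_retract ret)).
Qed.

Lemma ext1_projectiveP M : (forall N, ext1_vanishes N M) -> projective M.
Proof.
move=> M0; have [A [P [f [g [S prP]]]]] := projective_presentation M.
have [h hE] := ext1_hom_lift S (M0 A) (idfun : {linear M -> M}).
by apply: (projective_retract prP); exists h, g.
Qed.

Lemma zero_projective M : ~ nonzero M -> projective M.
Proof.
move=> M0 U V g f _; exists \0 => x; rewrite linear0.
have [->|x0] := eqVneq x 0; first by rewrite linear0.
by case: M0; exists x.
Qed.

(** * Total reflexivity under reducible complexity *)

Section LocalRing.
Variable m : set R.
Hypotheses (noethR : noetherian R) (locR : local_ring m).

Lemma regular_nonzero : nonzero (R^o : lmodType R).
Proof. by exists (1 : R^o); apply: oner_neq0. Qed.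

Lemma rc_totally_reflexive X : reducible_complexity m X ->
  (forall i, ext_vanishes R^o i.+1 X) ->
  reflexive_module X /\ forall i, ext_vanishes R^o i.+1 (dual X).
Proof.
elim=> {X} [X n fgX pdX|X c P beta t f K j k c' d fgX _ _ minP push _ _ _ _ _ IH] X0.
  (* When X is nonzero, Ext^b(X, R) is nonzero in the exact degree b. The hypothesis leaves only b =
     0, so X is projective. *)
  suff prX : projective X.
    have [l ret] := fg_projective_retract fgX prX.
    have [Xrefl prX'] := reflexive_rV_retract ret.
    by split=> // i; apply: ext_projective.
  have [nzX|] := pselect (nonzero X); last exact: zero_projective.
  have [N|b [bX bN]] := finite_pd_ext_degree noethR locR fgX (n := n).
    exact: pd_le_ext.
  have [nb _] := bN nzX _ (fg_regular R) regular_nonzero.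
  apply: ext1_projectiveP => N; apply: (bX N 1%N).
  by case: b nb {bX bN} => // b [].
have [h S] := reduction_short_exact push.
have free i : retract (P i) 'rV[R]_(beta i).
  have [[e ebij] _] := (minP.1 i, tt).
  by apply: linear_inverse (bij_inj ebij) (bijective_surjective ebij).
have syz0 i l : ext_vanishes R^o i.+1 (syzygy P l) by apply/ext_syzygy.
have [i|Krefl K0] := IH; first exact: ext_middle S (X0 i) (syz0 i t).
have Xinj : injective (@biduality R X).
  have [jinj _ _] := S => x y e; apply/jinj/(bij_inj Krefl).
  by rewrite -!biduality_natural e.
(* Positive syzygies embed in free modules, hence in their biduals; for l = 0 the syzygy is X, which
   embeds in the reflexive module K. *)
have syzinj l : injective (@biduality R (syzygy P l)).
  case: l => // l x y e; apply: val_inj.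
  apply: (bij_inj (reflexive_rV_retract (free l)).1).
  by rewrite -!(biduality_natural (syzygy_incl P l)) e.
have Xrefl : reflexive_module X := reflexive_left S (syz0 0%N t) Krefl (syzinj t).
have syzrefl l : reflexive_module (syzygy P l).
  elim: l => // l _; have [g Sl] := syzygy_presentation P l.
  exact: reflexive_left Sl (syz0 0%N l) (reflexive_rV_retract (free l)).1 (syzinj l).
(* Strong induction is needed because the syzygy in the reduction is reached from X itself: along 0
   -> Z* -> P* -> Y* -> 0, with Y the syzygy of Z, vanishing in degrees up to i + 1 passes from the
   dual of X to the duals of all syzygies. *)
split=> // i; elim/ltn_ind: i => -[_|i IHi].
  exact: ext1_dual_left S (syz0 0%N t) (K0 0%N) (bijective_surjective (syzrefl t)).
have syzdual l s : (s <= i)%N -> ext_vanishes R^o s.+1 (dual (syzygy P l)).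
  elim: l s => [|l IHl] s si; first exact: IHi.
  have [g Sl] := syzygy_presentation P l.
  have prd := (reflexive_rV_retract (free l)).2.
  case: s si => [_|s si].
    exact: ext1_dual_left Sl (syz0 0%N l) (ext1_projective prd) (bijective_surjective (syzrefl l)).
  have D := dual_short_exact Sl (syz0 0%N l).
  by apply: ext_right D (IHl s (ltnW si)) _; apply: ext_projective.
have D := dual_short_exact S (syz0 0%N t).
exact: ext_right D (syzdual t i (leqnn i)) (K0 i.+1).
Qed.

End LocalRing.
End Duality.

(** * The five conditions *)

Theorem corollary1p3 (R : comNzRingType) (M : lmodType R)
    (noethR : noetherian R)
    (fgM : finitely_generated M) (rcM : has_reducible_complexity M) :
  auslander_condition M /\
  (nonzero M -> uniform_auslander_condition M) /\
  auslander_reiten M /\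
  generalized_auslander_reiten M /\
  dependence_of_total_reflexivity M.
Proof.
have [m locR rcM'] := rcM.
have [b bM] := rc_ext_degree noethR locR rcM'.
have gar : generalized_auslander_reiten M.
  move=> n H.
  have [i1 i1E] : exists h : {linear M -> (M * R^o)%type}, forall x, h x = (x, 0).
    by apply: linear_fun_exists => a x y; congr pair; rewrite /= scaler0 addr0.
  have [i2 i2E] : exists h : {linear R^o -> (M * R^o)%type}, forall x, h x = (0, x).
    by apply: linear_fun_exists => a x y; congr pair; rewrite /= scaler0 addr0.
  have MM i : (n < i)%N -> ext_vanishes M i M.
    move=> ni; have /Ext_zeroP := H i ni; apply: ext_second_retract.
    by exists i1, fst => x; rewrite i1E.
  have MR i : (n < i)%N -> ext_vanishes R^o i M.
    move=> ni; have /Ext_zeroP := H i ni; apply: ext_second_retract.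
    by exists i2, snd => x; rewrite i2E.
  have [nzM|zM] := pselect (nonzero M); last first.
    by apply: (@pd_leW _ _ 0) => //; apply/pd_le_projective/zero_projective.
  have ev N : (forall i, (n < i)%N -> ext_vanishes N i M) ->
      exists k, forall i, (k <= i)%N -> ext_vanishes N i M by exists n.+1.
  (* For nonzero M, Ext^b(M, R) is nonzero, while the hypothesis makes it vanish in all degrees
     above n. *)
  have bn : (b <= n)%N.
    rewrite leqNgt; apply/negP => nb.
    have [_ h] := bM _ (fg_regular R) (ev _ MR).
    exact: (h nzM (regular_nonzero R)) (MR b nb).
  apply: pd_leW bn _; apply: (pd_le_of_self_ext noethR fgM _ (ev _ MM) (ev _ MR)).
  by move=> N fgN N0; case: (bM N fgN N0).
split; [|split; [|split; [|split=> //]]].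
- exists b => N fgN /Ext_eventually_zeroP N0 i bi; apply/Ext_zeroP.
  by case: (bM N fgN N0) => h _; apply: h.
(* For M = 0 every Ext vanishes, so nonvanishing in degree b is asserted for nonzero M. *)
- move=> nzM; exists b => N fgN nzN /Ext_eventually_zeroP N0.
  have [h1 h2] := bM N fgN N0; split=> [i /h1 /Ext_zeroP //|/Ext_zeroP].
  exact: h2.
(* The case n = 0 of the generalized conjecture gives projective dimension 0, hence vanishing of all
   Ext^1 from M. *)
- move=> H; apply: ext1_projectiveP => N.
  exact: (pd_le_ext N (gar 0%N H)).
- move=> H; have [|Mrefl M0] := rc_totally_reflexive noethR locR rcM'.
    by move=> i; apply/Ext_zeroP; apply: H.
  by split=> // -[|i] // _; apply/Ext_zeroP.
Qed.
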